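(* Let $B$ be a finite dimensional algebra over an algebraically closed field $k$ and let $A=B[P_0]$ be the one-point extension of $B$ by a projective $B$-module $P_0$. Then the map $e:\mathrm{s}\tau\text{-}\mathrm{tilt}\,B\to \mathrm{s}\tau\text{-}\mathrm{tilt}\,A$, $(M,Q)\mapsto(\mathcal{E}M\oplus S,Q)$, induces a full embedding of quivers $e:Q(\mathrm{s}\tau\text{-}\mathrm{tilt}\,B)\to Q(\mathrm{s}\tau\text{-}\mathrm{tilt}\,A)$.
   Context: All algebras are basic connected finite dimensional algebras over an algebraically closed field $k$; $\mathrm{mod}\,C$ is the category of finitely generated left $C$-modules. The one-point extension of $B$ by $P_0$ is the matrix algebra $A=B[P_0]=\begin{pmatrix} B & P_0\\ 0 & k\end{pmatrix}$. There is a unique indecomposable projective $A$-module $\widetilde P$ which is not a projective $B$-module, and $S$ is its simple top. $\mathrm{mod}\,B$ is regarded as embedded in $\mathrm{mod}\,A$ in the usual way (via the projection $A\to B$); projective $B$-modules are then projective $A$-modules. Let $U=e_BA$ with $e_B$ the identity of $B$, a $B$-$A$-bimodule; the extension functor is $\mathcal{E}=\mathrm{Hom}_B(U,-):\mathrm{mod}\,B\to\mathrm{mod}\,A$. For an algebra $C$, $|M|$ is the number of pairwise non-isomorphic indecomposable direct summands of $M$. A $C$-module $M$ is $\tau$-rigid if $\mathrm{Hom}_C(M,\tau_C M)=0$; $\tau$-tilting if moreover $|M|=|C|$; support $\tau$-tilting if it is a $\tau$-tilting $C/\langle e\rangle$-module for some idempotent $e$. A pair $(M,P)$ with $P$ a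 projective $C$-module is a $\tau$-rigid pair if $M$ is $\tau$-rigid and $\mathrm{Hom}_C(P,M)=0$; it is a support $\tau$-tilting pair (almost complete support $\tau$-tilting pair) if in addition $|M|+|P|=|C|$ (resp. $|M|+|P|=|C|-1$). Basic support $\tau$-tilting modules $M$ correspond bijectively to basic support $\tau$-tilting pairs $(M,P)$, and the two notions are identified. $\mathrm{s}\tau\text{-}\mathrm{tilt}\,C$ is the set of isomorphism classes of basic support $\tau$-tilting $C$-modules (equivalently pairs), partially ordered by $M\le T$ iff $\mathrm{Fac}\,M\subseteq\mathrm{Fac}\,T$, where $\mathrm{Fac}\,X$ is the class of factor modules of finite direct sums of copies of $X$. Each basic almost complete support $\tau$-tilting pair is a direct summand of exactly two basic support $\tau$-tilting pairs, called mutations of each other; $T'$ is a left mutation of $T$ if they are mutations of each other and $T>T'$. The quiver $Q(\mathrm{s}\tau\text{-}\mathrm{tilt}\,C)$ has vertex set $\mathrm{s}\tau\text{-}\mathrm{tilt}\,C$ and an arrow $T\to T'$ iff $T'$ is a left mutation of $T$; it coincides with the Hasse quiver of the poset. A full embedding of quivers means an injective map on vertices such that there is an arrow from $x$ to $y$ if and only if there is an arrow from $e(x)$ to $e(y)$. *)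

(* Defs.v *)
From HB Require Import structures.
From mathcomp Require Import all_boot all_order all_algebra all_field.

Set Implicit Arguments.
Unset Strict Implicit.
Unset Printing Implicit Defensive.

Import GRing.Theory.
Local Open Scope ring_scope.

(* The library gives the converse ring C^c no algebra structure. *)
Section Opposite.
Variables (k : fieldType) (C : falgType k).

HB.instance Definition _ := GRing.Lmodule.copy C^c C.
HB.instance Definition _ := Vector.copy C^c C.

Fact opp_scalerAl (a : k) (x y : C^c) : a *: (x * y) = (a *: x : C^c) * y.
Proof.
by change (a *: ((y : C) * (x : C)) = (y : C) * (a *: (x : C))); rewrite scalerAr.
Qed.
HB.instance Definition _ := GRing.Lmodule_isLalgebra.Build k C^c opp_scalerAl.

Fact opp_scalerAr (a : k) (x y : C^c) : a *: (x * y) = x * (a *: y : C^c).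
Proof.
by change (a *: ((y : C) * (x : C)) = (a *: (y : C)) * (x : C)); rewrite scalerAl.
Qed.
HB.instance Definition _ := GRing.Lalgebra_isAlgebra.Build k C^c opp_scalerAr.
End Opposite.

(* Finitely generated left C-modules, i.e. the objects of mod C: since C is
   finite dimensional over k these are the finite dimensional k-spaces with a
   k-bilinear, unital and associative action of C.  Right C-modules are the
   objects of type fdmod C^c. *)
Record fdmod (k : fieldType) (C : falgType k) := FdMod {
  carrier :> vectType k;
  act : C -> carrier -> carrier;
  act_linear : forall a, linear (act a);
  act_linearl : forall v, linear (act^~ v);
  act1 : forall v, act 1 v = v;
  actM : forall a b v, act (a * b) v = act a (act b v)
}.

Section ActLinear.
Variables (k : fieldType) (C : falgType k) (M : fdmod C).
HB.instance Definition _ (a : C) :=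
  GRing.isLinear.Build k M M *:%R (@act k C M a) (@act_linear k C M a).

Definition act_lfun (a : C) : 'End(M) := linfun (@act k C M a).

Fact act_lfun_linear : linear act_lfun.
Proof.
move=> x a b; apply/lfunP=> v.
by rewrite !(add_lfunE, scale_lfunE) !lfunE /= (@act_linearl _ _ M v x a b).
Qed.
HB.instance Definition _ :=
  GRing.isLinear.Build k C 'End(M) *:%R act_lfun act_lfun_linear.
End ActLinear.

Section Modules.
Variables (k : fieldType) (C : falgType k).
Implicit Types (M N X Y P Q : fdmod C).

Section Hom.
Variables M N : fdmod C.

Definition comm_act (f : 'Hom(M, N)) (a : C) : 'Hom(M, N) :=
  ((act_lfun N a \o f) - (f \o act_lfun M a))%VF.

Fact comm_act_linear f : linear (comm_act f).
Proof.
move=> x a b; apply/lfunP=> v; rewrite /comm_act !act_lfun_linear.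
rewrite !(add_lfunE, scale_lfunE, opp_lfunE, comp_lfunE) linearP.
by rewrite opprD addrACA scalerBr.
Qed.
HB.instance Definition _ (f : 'Hom(M, N)) :=
  GRing.isLinear.Build k C 'Hom(M, N) *:%R (comm_act f) (comm_act_linear f).

Definition hom_defect (f : 'Hom(M, N)) : 'Hom(C, 'Hom(M, N)) :=
  linfun (comm_act f).

Lemma hom_defectE f a v :
  hom_defect f a v = act a (f v) - f (act a v).
Proof. by rewrite lfunE /= add_lfunE opp_lfunE !comp_lfunE !lfunE. Qed.

Fact hom_defect_linear : linear hom_defect.
Proof.
move=> x f g; apply/lfunP=> a; apply/lfunP=> v.
rewrite !(add_lfunE, scale_lfunE) !hom_defectE !(add_lfunE, scale_lfunE).
by rewrite linearP opprD addrACA scalerBr.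
Qed.
HB.instance Definition _ :=
  GRing.isLinear.Build k 'Hom(M, N) 'Hom(C, 'Hom(M, N)) *:%R
    hom_defect hom_defect_linear.

(* Hom_C(M, N), as a subspace of Hom_k(M, N); see homP. *)
Definition modhom : {vspace 'Hom(M, N)} := lker (linfun hom_defect).

Lemma homP (f : 'Hom(M, N)) :
  reflect (forall a v, f (act a v) = act a (f v)) (f \in modhom).
Proof.
rewrite memv_ker lfunE; apply: (iffP eqP) => [f0 a v | fC].
  apply/esym/eqP; rewrite -subr_eq0 -hom_defectE.
  by rewrite f0 !zero_lfunE.
apply/lfunP=> a; apply/lfunP=> v.
by rewrite hom_defectE fC subrr zero_lfunE zero_lfunE.
Qed.
End Hom.

Definition iso M N := exists2 f : 'Hom(M, N), f \in modhom M N & bijective f.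

Definition zero M := \dim {:M} = 0%N.

Definition submodule M (U : {vspace M}) := forall a v, v \in U -> act a v \in U.

Section DirectSum.
Variables M N : fdmod C.
Definition dsum_act (a : C) (v : M * N) : M * N := (act a v.1, act a v.2).
Fact dsum_act_linear a : linear (dsum_act a).
Proof. by move=> x u v; rewrite /dsum_act /= !linearP. Qed.
Fact dsum_act_linearl v : linear (dsum_act^~ v).
Proof. by move=> x a b; rewrite /dsum_act !act_linearl. Qed.
Fact dsum_act1 v : dsum_act 1 v = v.
Proof. by case: v => u v; rewrite /dsum_act !act1. Qed.
Fact dsum_actM a b v : dsum_act (a * b) v = dsum_act a (dsum_act b v).
Proof. by rewrite /dsum_act !actM. Qed.
Definition dsum : fdmod C :=
  FdMod dsum_act_linear dsum_act_linearl dsum_act1 dsum_actM.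
End DirectSum.

Section Power.
Variables (n : nat) (M : fdmod C).
Definition pow_act (a : C) (v : {ffun 'I_n -> M}) : {ffun 'I_n -> M} :=
  [ffun i => act a (v i)].
Fact pow_act_linear a : linear (pow_act a).
Proof. by move=> x u v; apply/ffunP=> i; rewrite !ffunE linearP. Qed.
Fact pow_act_linearl v : linear (pow_act^~ v).
Proof. by move=> x a b; apply/ffunP=> i; rewrite !ffunE act_linearl. Qed.
Fact pow_act1 v : pow_act 1 v = v.
Proof. by apply/ffunP=> i; rewrite !ffunE act1. Qed.
Fact pow_actM a b v : pow_act (a * b) v = pow_act a (pow_act b v).
Proof. by apply/ffunP=> i; rewrite !ffunE actM. Qed.
Definition pow : fdmod C :=
  FdMod pow_act_linear pow_act_linearl pow_act1 pow_actM.
End Power.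

Definition summand X M := exists Y, iso M (dsum X Y).

Definition indecomposable M :=
  ~ zero M /\ forall X Y, iso M (dsum X Y) -> zero X \/ zero Y.

Definition basic M :=
  forall X Y, indecomposable X -> indecomposable Y ->
    summand (dsum X Y) M -> ~ iso X Y.

(* |M| = n *)
Definition num_summands M (n : nat) :=
  exists X : 'I_n -> fdmod C,
    [/\ forall i, indecomposable (X i) /\ summand (X i) M,
        forall i j, iso (X i) (X j) -> i = j
      & forall Y, indecomposable Y -> summand Y M -> exists i, iso Y (X i)].

Definition projective P :=
  forall (X Y : fdmod C) (g : 'Hom(X, Y)) (h : 'Hom(P, Y)),
    g \in modhom X Y -> limg g = fullv -> h \in modhom P Y ->
    exists2 h' : 'Hom(P, X), h' \in modhom P X & (g \o h')%VF = h.

(* Fac M X: the module X belongs to Fac M. *)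
Definition Fac M X :=
  exists n, exists2 f : 'Hom(pow n M, X), f \in modhom (pow n M) X & limg f = fullv.

Definition superfluous M (U : {vspace M}) :=
  forall W : {vspace M}, submodule W -> (U + W)%VS = fullv -> W = fullv.

(* P1 -f-> P0 -g-> M -> 0 is a minimal projective presentation: both g and
   f : P1 -> Ker g are projective covers. *)
Definition min_presentation P1 P0 M (f : 'Hom(P1, P0)) (g : 'Hom(P0, M)) :=
  [/\ projective P1 /\ projective P0,
      f \in modhom P1 P0 /\ g \in modhom P0 M,
      limg g = fullv /\ limg f = lker g
    & superfluous (lker g) /\ superfluous (lker f)].

Definition maximal M (U : {vspace M}) :=
  [/\ submodule U, U <> fullv
    & forall W : {vspace M}, submodule W -> (U <= W)%VS -> W = U \/ W = fullv].

(* S is the top M / rad M of M, rad M being the intersection of the maximal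
   submodules of M. *)
Definition is_top (M S : fdmod C) :=
  exists2 f : 'Hom(M, S), f \in modhom M S &
    limg f = fullv /\
    forall v, v \in lker f <-> forall U : {vspace M}, maximal U -> v \in U.

End Modules.

Fact subvs_linear (k : fieldType) (V : vectType k) (U : {vspace V}) :
  linear (@vsval k V U).
Proof. by []. Qed.

Section Regular.
Variables (k : fieldType) (C : falgType k).
Definition reg_act (a x : C) : C := a * x.
Fact reg_act_linear a : linear (reg_act a).
Proof. by move=> x u v; rewrite /reg_act mulrDr scalerAr. Qed.
Fact reg_act_linearl v : linear (reg_act^~ v).
Proof. by move=> x a b; rewrite /reg_act mulrDl scalerAl. Qed.
Fact reg_act1 v : reg_act 1 v = v. Proof. exact: mul1r. Qed.
Fact reg_actM a b v : reg_act (a * b) v = reg_act a (reg_act b v).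
Proof. by rewrite /reg_act mulrA. Qed.
Definition regular : fdmod C :=
  FdMod reg_act_linear reg_act_linearl reg_act1 reg_actM.
End Regular.

Definition basic_algebra (k : fieldType) (C : falgType k) := basic (regular C).

Definition connected_algebra (k : fieldType) (C : falgType k) :=
  forall c : C, c * c = c -> (forall x, c * x = x * c) -> c = 0 \/ c = 1.

(* The right module Hom_C(P, C), with (g c)(x) = g(x) c. *)
Section StarDual.
Variables (k : fieldType) (C : falgType k) (P : fdmod C).
Local Notation H := (modhom P (regular C)).

Definition star_act (c : C^c) (g : subvs_of H) : subvs_of H :=
  vsproj H (amulr (c : C) \o vsval g)%VF.

Lemma star_actE c g x : vsval (star_act c g) x = vsval g x * (c : C).
Proof.
rewrite /star_act vsprojK ?comp_lfunE ?lfunE //.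
apply/homP=> a v; rewrite !comp_lfunE !lfunE /= /reg_act.
by have /homP-> := subvsP g; rewrite /= /reg_act mulrA.
Qed.

Fact star_act_linear c : linear (star_act c).
Proof.
move=> x u v; apply/subvs_inj/lfunP=> y.
rewrite subvs_linear add_lfunE scale_lfunE !star_actE subvs_linear.
by rewrite add_lfunE scale_lfunE mulrDl scalerAl.
Qed.
Fact star_act_linearl g : linear (star_act^~ g).
Proof.
move=> x a b; apply/subvs_inj/lfunP=> y.
rewrite subvs_linear add_lfunE scale_lfunE !star_actE.
by apply: etrans (mulrDr _ _ _) _; congr (_ + _); apply/esym/scalerAr.
Qed.
Fact star_act1 g : star_act 1 g = g.
Proof. by apply/subvs_inj/lfunP=> y; rewrite star_actE mulr1. Qed.
Fact star_actM a b g : star_act (a * b) g = star_act a (star_act b g).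
Proof. by apply/subvs_inj/lfunP=> y; rewrite !star_actE -mulrA. Qed.
Definition star : fdmod C^c :=
  FdMod star_act_linear star_act_linearl star_act1 star_actM.
End StarDual.

(* Hom_C(f, C) : Hom_C(P0, C) -> Hom_C(P1, C) for f : P1 -> P0 in mod C. *)
Section StarMap.
Variables (k : fieldType) (C : falgType k) (P1 P0 : fdmod C).
Variable f : 'Hom(P1, P0).

Definition star_map_fun (g : star P0) : star P1 :=
  vsproj (modhom P1 (regular C)) (vsval g \o f)%VF.

Fact star_map_linear : linear star_map_fun.
Proof.
move=> x g h; rewrite /star_map_fun -linearP; congr (vsproj _ _).
apply/lfunP=> v; rewrite comp_lfunE [RHS]add_lfunE scale_lfunE !comp_lfunE.
have /lfunP/(_ (f v)) := @subvs_linear k _ (modhom P0 (regular C)) x g h.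
by rewrite add_lfunE scale_lfunE.
Qed.
HB.instance Definition _ :=
  GRing.isLinear.Build k (star P0) (star P1) *:%R star_map_fun star_map_linear.

Definition star_map : 'Hom(star P0, star P1) := linfun star_map_fun.

Lemma star_mapE g v : f \in modhom P1 P0 ->
  vsval (star_map g) v = vsval g (f v).
Proof.
move=> /homP fC; rewrite lfunE /= vsprojK ?comp_lfunE //.
apply/(@homP k C P1 (regular C))=> a w; rewrite !comp_lfunE fC.
by have /homP-> := @subvsP k _ (modhom P0 (regular C)) g.
Qed.
End StarMap.

(* The k-dual of a right C-module, a left module via (c phi)(t) = phi(t c). *)
Section KDual.
Variables (k : fieldType) (C : falgType k) (T : fdmod C^c).
Definition kdual_act (c : C) (phi : 'Hom(T, k^o)) : 'Hom(T, k^o) :=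
  (phi \o act_lfun T c)%VF.
Lemma kdual_actE c phi t : kdual_act c phi t = phi (act (c : C^c) t).
Proof. by rewrite comp_lfunE lfunE. Qed.
Fact kdual_act_linear c : linear (kdual_act c).
Proof. by move=> x u v; rewrite /kdual_act comp_lfunDl comp_lfunZl. Qed.
Fact kdual_act_linearl phi : linear (kdual_act^~ phi).
Proof.
move=> x a b; apply/lfunP=> t.
by rewrite !(add_lfunE, scale_lfunE) !kdual_actE act_linearl linearP.
Qed.
Fact kdual_act1 phi : kdual_act 1 phi = phi.
Proof. by apply/lfunP=> t; rewrite kdual_actE (@act1 k C^c T t). Qed.
Fact kdual_actM a b phi : kdual_act (a * b) phi = kdual_act a (kdual_act b phi).
Proof. by apply/lfunP=> t; rewrite !kdual_actE -(@actM k C^c T). Qed.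
Definition kdual : fdmod C :=
  FdMod kdual_act_linear kdual_act_linearl kdual_act1 kdual_actM.
End KDual.

Section TauTilting.
Variables (k : fieldType) (C : falgType k).
Implicit Types (M X : fdmod C).

(* T is the transpose of M: for a minimal projective presentation
   P1 -> P0 -> M -> 0, the sequence
   Hom_C(P0, C) -> Hom_C(P1, C) -> T -> 0 is exact. *)
Definition is_transpose M (T : fdmod C^c) :=
  exists (P1 P0 : fdmod C) (f : 'Hom(P1, P0)) (g : 'Hom(P0, M))
         (q : 'Hom(star P1, T)),
    [/\ min_presentation f g, q \in modhom (star P1) T,
        lker q = limg (star_map f) & limg q = fullv].

(* N is the Auslander-Reiten translate tau M = D Tr M (unique up to iso). *)
Definition is_tau (M N : fdmod C) := exists2 T, is_transpose M T & iso N (kdual T).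

Definition tau_rigid M := exists2 N, is_tau M N & modhom M N = 0%VS.

(* A pair (M, P) is represented by T : fdmod C * fdmod C. *)
Definition mod_pair := (fdmod C * fdmod C)%type.
Implicit Types T : mod_pair.

Definition pair_iso T T' := iso T.1 T'.1 /\ iso T.2 T'.2.

Definition pair_summand (N T : mod_pair) := summand N.1 T.1 /\ summand N.2 T.2.

Definition basic_pair T := basic T.1 /\ basic T.2.

Definition tau_rigid_pair T :=
  [/\ projective T.2, tau_rigid T.1 & modhom T.2 T.1 = 0%VS].

(* |M| + |P| = n *)
Definition pair_size T n :=
  exists m p, [/\ num_summands T.1 m, num_summands T.2 p & (m + p)%N = n].

Definition support_tau_tilting_pair T :=
  tau_rigid_pair T /\
  exists2 n, num_summands (regular C) n & pair_size T n.

Definition almost_complete_pair T :=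
  tau_rigid_pair T /\
  exists2 n, num_summands (regular C) n.+1 & pair_size T n.

(* T represents an element of s\tau-tilt C *)
Definition stau_tilt T := basic_pair T /\ support_tau_tilting_pair T.

Definition stau_le T T' := forall X, Fac T.1 X -> Fac T'.1 X.

Definition stau_lt T T' := stau_le T T' /\ ~ pair_iso T T'.

Definition mutation T T' :=
  ~ pair_iso T T' /\
  exists N, [/\ basic_pair N, almost_complete_pair N,
                pair_summand N T & pair_summand N T'].

Definition left_mutation T T' := mutation T T' /\ stau_lt T' T.

End TauTilting.

(* Quivers without multiple arrows, whose vertices are the v : vtype such that
   is_vertex v, taken up to the relation same_vertex. *)
Record quiver := Quiver {
  vtype : Type;
  is_vertex : vtype -> Prop;
  same_vertex : vtype -> vtype -> Prop;
  arrow : vtype -> vtype -> Prop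
}.

Definition Q_stau_tilt (k : fieldType) (C : falgType k) : quiver :=
  {| vtype := mod_pair C;
     is_vertex := @stau_tilt k C;
     same_vertex := @pair_iso k C;
     arrow := @left_mutation k C |}.

(* e induces a well defined injective map on vertices that preserves and
   reflects arrows. *)
Definition full_embedding (Q Q' : quiver) (e : vtype Q -> vtype Q') :=
  [/\ forall x, is_vertex x -> is_vertex (e x),
      forall x y, is_vertex x -> is_vertex y ->
        same_vertex x y -> same_vertex (e x) (e y),
      forall x y, is_vertex x -> is_vertex y ->
        same_vertex (e x) (e y) -> same_vertex x y
    & forall x y, is_vertex x -> is_vertex y ->
        (arrow x y <-> arrow (e x) (e y))].

(* The one-point extension B[P0]: the triple (b, p, x) is the matrix
     ( b  p )
     ( 0  x ),
   where x : k acts on P0 on the right by scaling. *)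
Definition onept (k : fieldType) (B : falgType k) (P0 : fdmod B) : Type :=
  (B * P0 * k^o)%type.

Section OnePoint.
Variables (k : fieldType) (B : falgType k) (P0 : fdmod B).
Local Notation A := (onept P0).

HB.instance Definition _ := Vector.copy A (B * P0 * k^o)%type.

Definition onept_one : A := (1, 0, 1).
Definition onept_mul (u v : A) : A :=
  (u.1.1 * v.1.1, act u.1.1 v.1.2 + (v.2 : k) *: u.1.2, (u.2 : k) * v.2).

Fact onept_mulA : associative onept_mul.
Proof.
move=> [[b p] x] [[c q] y] [[d r] z]; rewrite /onept_mul /=.
rewrite !mulrA linearD linearZ /= actM scalerDr scalerA addrA.
by rewrite (mulrC z y).
Qed.
Fact onept_mul1l : left_id onept_one onept_mul.
Proof. by move=> [[b p] x]; rewrite /onept_mul /= !mul1r act1 scaler0 addr0. Qed.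
Fact onept_mul1r : right_id onept_one onept_mul.
Proof. by move=> [[b p] x]; rewrite /onept_mul /= !mulr1 linear0 scale1r add0r. Qed.
Fact onept_mulDl : left_distributive onept_mul +%R.
Proof.
move=> [[b p] x] [[c q] y] [[d r] z]; rewrite /onept_mul /=.
have := @act_linearl _ _ P0 r 1 b c; rewrite !scale1r /= => E.
by congr (_, _, _); rewrite /= ?mulrDl // E scalerDr addrACA.
Qed.
Fact onept_mulDr : right_distributive onept_mul +%R.
Proof.
move=> [[b p] x] [[c q] y] [[d r] z]; rewrite /onept_mul /=.
by congr (_, _, _); rewrite /= ?mulrDr // linearD scalerDl addrACA.
Qed.
Fact onept_one_neq0 : onept_one != 0.
Proof. by apply/eqP=> -[/eqP]; rewrite oner_eq0. Qed.
HB.instance Definition _ := GRing.Zmodule_isNzRing.Build A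
  onept_mulA onept_mul1l onept_mul1r onept_mulDl onept_mulDr onept_one_neq0.

Fact onept_scalerAl (a : k) (u v : A) : a *: (u * v) = (a *: u) * v.
Proof.
case: u v => [[b p] x] [[c q] y].
have := @act_linearl _ _ P0 q a b 0; rewrite !addr0 /=.
have := @act_linearl _ _ P0 q (-1) 0 0; rewrite scaler0 addr0 scaleN1r addNr /=.
move=> ->; rewrite addr0 => E.
by congr (_, _, _); rewrite /= ?scalerAl ?E // scalerDr !scalerA mulrC.
Qed.
HB.instance Definition _ := GRing.Lmodule_isLalgebra.Build k A onept_scalerAl.

Fact onept_scalerAr (a : k) (u v : A) : a *: (u * v) = u * (a *: v).
Proof.
case: u v => [[b p] x] [[c q] y].
by congr (_, _, _); rewrite /= ?scalerAr // linearZ scalerDr !scalerA.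
Qed.
HB.instance Definition _ := GRing.Lalgebra_isAlgebra.Build k A onept_scalerAr.
HB.instance Definition _ := Algebra_isFalgebra.Build k A.

Definition onept_proj (a : A) : B := a.1.1.
Definition onept_inj (b : B) : A := (b, 0, 0).
Definition onept_e : A := onept_inj 1.

(* The embedding mod B -> mod A along the projection A -> B. *)
Section Inflation.
Variable M : fdmod B.
Definition infl_act (a : A) (v : M) : M := act (onept_proj a) v.
Fact infl_act_linear a : linear (infl_act a).
Proof. exact: act_linear. Qed.
Fact infl_act_linearl v : linear (infl_act^~ v).
Proof. by move=> x a b; rewrite /infl_act /onept_proj /= act_linearl. Qed.
Fact infl_act1 v : infl_act 1 v = v. Proof. exact: act1. Qed.
Fact infl_actM a b v : infl_act (a * b) v = infl_act a (infl_act b v).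
Proof. exact: actM. Qed.
Definition infl : fdmod (onept P0) :=
  FdMod infl_act_linear infl_act_linearl infl_act1 infl_actM.
End Inflation.

(* U = e_B A as a left B-module; its right A-action is extU_r. *)
Definition extU_space : {vspace onept P0} := limg (amull onept_e).

Lemma extU_spaceP (u : A) : reflect (onept_e * u = u) (u \in extU_space).
Proof.
apply: (iffP idP) => [/memv_imgP[v _ ->] | <-].
  rewrite lfunE /= mulrA; congr (_ * _).
  by congr (_, _, _); rewrite /= ?mulr1 ?mulr0 // linear0 scaler0 addr0.
by apply/memv_imgP; exists u; rewrite ?memvf // lfunE.
Qed.

Definition extU_act (b : B) (u : subvs_of extU_space) : subvs_of extU_space :=
  vsproj extU_space (onept_inj b * vsval u).

Lemma extU_actE b u : vsval (extU_act b u) = onept_inj b * vsval u.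
Proof.
rewrite vsprojK //; apply/extU_spaceP; rewrite mulrA; congr (_ * _).
by congr (_, _, _); rewrite /= ?mul1r ?mul0r // linear0 scale0r addr0.
Qed.

Fact onept_inj_linear : linear onept_inj.
Proof. by move=> x a b; congr (_, _, _); rewrite /= scaler0 addr0. Qed.

Fact extU_act_linear b : linear (extU_act b).
Proof.
move=> x u v; apply: subvs_inj; rewrite subvs_linear !extU_actE subvs_linear.
by rewrite mulrDr scalerAr.
Qed.
Fact extU_act_linearl u : linear (extU_act^~ u).
Proof.
move=> x a b; apply: subvs_inj; rewrite subvs_linear !extU_actE.
by rewrite onept_inj_linear mulrDl scalerAl.
Qed.
Fact extU_act1 u : extU_act 1 u = u.
Proof. by apply: subvs_inj; rewrite extU_actE; apply/extU_spaceP/subvsP. Qed.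
Fact extU_actM a b u : extU_act (a * b) u = extU_act a (extU_act b u).
Proof.
apply: subvs_inj; rewrite !extU_actE mulrA; congr (_ * _).
by congr (_, _, _); rewrite /= ?mul0r // linear0 scale0r addr0.
Qed.
Definition extU : fdmod B :=
  FdMod extU_act_linear extU_act_linearl extU_act1 extU_actM.

Definition extU_r_fun (a : onept P0) (u : extU) : extU :=
  vsproj extU_space (vsval u * a).

Lemma extU_r_funE a u : vsval (extU_r_fun a u) = vsval u * a.
Proof.
rewrite vsprojK //; apply/extU_spaceP; rewrite mulrA; congr (_ * _).
exact/extU_spaceP/subvsP.
Qed.

Fact extU_r_fun_linear a : linear (extU_r_fun a).
Proof.
move=> x u v; apply: subvs_inj; rewrite subvs_linear !extU_r_funE subvs_linear.
by rewrite mulrDl scalerAl.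
Qed.
HB.instance Definition _ a :=
  GRing.isLinear.Build k extU extU *:%R (extU_r_fun a) (extU_r_fun_linear a).

Definition extU_r (a : onept P0) : 'End(extU) := linfun (extU_r_fun a).

Lemma extU_rE a u : vsval (extU_r a u) = vsval u * a.
Proof. by rewrite lfunE extU_r_funE. Qed.

(* The extension functor E = Hom_B(U, -), with (a f)(u) = f(u a). *)
Section Extension.
Variable M : fdmod B.
Local Notation H := (modhom extU M).

Definition ext_act (a : onept P0) (f : subvs_of H) : subvs_of H :=
  vsproj H (vsval f \o extU_r a)%VF.

Lemma ext_actE a f u : vsval (ext_act a f) u = vsval f (extU_r a u).
Proof.
rewrite /ext_act vsprojK ?comp_lfunE //.
apply/homP=> b v; rewrite !comp_lfunE.
have /homP <- := subvsP f; congr (vsval f _).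
by apply: subvs_inj; rewrite extU_rE !extU_actE extU_rE mulrA.
Qed.

Fact ext_act_linear a : linear (ext_act a).
Proof.
move=> x u v; apply/subvs_inj/lfunP=> y.
rewrite subvs_linear add_lfunE scale_lfunE !ext_actE subvs_linear.
by rewrite add_lfunE scale_lfunE.
Qed.
Fact ext_act_linearl f : linear (ext_act^~ f).
Proof.
move=> x a b; apply/subvs_inj/lfunP=> y.
rewrite subvs_linear add_lfunE scale_lfunE !ext_actE -linearP.
congr (vsval f _); apply: subvs_inj.
by rewrite subvs_linear !extU_rE mulrDr scalerAr.
Qed.
Fact ext_act1 f : ext_act 1 f = f.
Proof.
apply/subvs_inj/lfunP=> y; rewrite ext_actE; congr (vsval f _).
by apply: subvs_inj; rewrite extU_rE mulr1.
Qed.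
Fact ext_actM a b f : ext_act (a * b) f = ext_act a (ext_act b f).
Proof.
apply/subvs_inj/lfunP=> y; rewrite !ext_actE; congr (vsval f _).
by apply: subvs_inj; rewrite !extU_rE mulrA.
Qed.
Definition ext : fdmod (onept P0) :=
  FdMod ext_act_linear ext_act_linearl ext_act1 ext_actM.
End Extension.

(* Pt is an indecomposable projective A-module that is not (the inflation of) a
   projective B-module. *)
Definition new_projective (Pt : fdmod (onept P0)) :=
  [/\ indecomposable Pt, projective Pt
    & ~ exists2 Q : fdmod B, projective Q & iso Pt (infl Q)].

(* (M, Q) |-> (E M (+) S, Q) *)
Definition ext_pair (S : fdmod (onept P0)) (T : mod_pair B) : mod_pair (onept P0) :=
  (dsum (ext T.1) S, infl T.2).

End OnePoint.

(* Main.v *)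
Require Import Defs.
From HB Require Import structures.
From mathcomp Require Import all_boot all_order all_algebra all_field.
From Stdlib Require Import Classical.

(* The functor E is right adjoint to X |-> e_B X and is fully faithful, the
   simple module S satisfies e_B S = 0, and Hom_A(S, E M) = 0.  By
   Krull-Schmidt the summands of E M (+) S are therefore the modules E N, with
   or without S, for N a summand of M, which gives the numbers of summands.

   A module M is tau-rigid iff for some projective presentation
   P1 -> P0 -> M -> 0 every map P1 -> M factors through P1 -> P0.  For
   E M (+) S there is such a presentation with P1 a projective B-module; under
   the adjunction its factorization problem becomes that of M.

   For the arrows: if e(x) and e(y) are distinct and share an almost complete
   summand, counting shows that S is part of it, so that it has the form
   (E N (+) S, Q) with (N, Q) a common summand of x and y.  Inclusions of Fac
   are transported because E is exact, P0 being projective, and they are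
   reflected by X |-> e_B X. *)

Set Implicit Arguments.
Unset Strict Implicit.
Unset Printing Implicit Defensive.

Import GRing.Theory.
Local Open Scope ring_scope.

(** * Homomorphisms, direct sums and retracts *)

(** The criterion for tau-rigidity rests on a duality: Hom(X, D Tr M) is dual to Tr M (x) X, and the
    latter is the cokernel of Hom(P0, X) -> Hom(P1, X) for the minimal presentation that defines Tr
    M. The first term of that presentation has to be a B-module: every map from it then lands in e_B
    (E M (+) S), a copy of M in which S has disappeared. Copies of A e_0 in the middle term, where
    e_0 = 1 - e_B, achieve this. Projectivity of the B-module that is extended enters twice: it
    makes U projective, so that E preserves surjections, and it makes e_B of the middle term
    projective over B. Summands are handled as retracts, because pairs of maps compose and are
    preserved and reflected by fully faithful functors. E and the inflation are both treated as
    instances of one abstract notion of such a functor. *)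

Section LinearMaps.
Variables (k : fieldType) (U V : vectType k).

Definition lin_of (f : U -> V) (fl : linear f) : {linear U -> V} :=
  HB.pack f (GRing.isLinear.Build k U V *:%R f fl).

Definition hom_of (f : U -> V) (fl : linear f) : 'Hom(U, V) :=
  linfun (lin_of fl).

Lemma hom_ofE f (fl : linear f) x : hom_of fl x = f x.
Proof. by rewrite lfunE. Qed.
End LinearMaps.

Section ModuleTheory.
Variables (k : fieldType) (C : falgType k).
Implicit Types (M N X Y Z P Q : fdmod C).

Lemma modhomE M N (f : 'Hom(M, N)) : f \in modhom M N ->
  forall a v, f (act a v) = act a (f v).
Proof. by move/homP. Qed.

Lemma act0 M a : act a (0 : M) = 0.
Proof. exact: linear0. Qed.
Lemma actB M a (x y : M) : act a (x - y) = act a x - act a y.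
Proof. exact: linearB. Qed.
Lemma act_sum M a I (r : seq I) (p : pred I) (F : I -> M) :
  act a (\sum_(i <- r | p i) F i) = \sum_(i <- r | p i) act a (F i).
Proof. exact: linear_sum. Qed.
Lemma actDl M a b (x : M) : act (a + b) x = act a x + act b x.
Proof. by have := act_linearl x 1 a b; rewrite !scale1r. Qed.
Lemma act0l M (x : M) : act 0 x = 0.
Proof. by apply: (addrI (act 0 x)); rewrite -actDl !addr0. Qed.
Lemma actZl M c a (x : M) : act (c *: a) x = c *: act a x.
Proof. by have := act_linearl x c a 0; rewrite !addr0 act0l addr0. Qed.
Lemma actBl M a b (x : M) : act (a - b) x = act a x - act b x.
Proof. by rewrite -scaleN1r actDl actZl scaleN1r. Qed.

Lemma modhom_of M N (f : M -> N) (fl : linear f) :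
  (forall a v, f (act a v) = act a (f v)) -> hom_of fl \in modhom M N.
Proof. by move=> fa; apply/homP=> a v; rewrite !hom_ofE. Qed.

Lemma modhom_id M : \1%VF \in modhom M M.
Proof. by apply/homP=> a v; rewrite !id_lfunE. Qed.
Lemma modhom_comp M N Q (g : 'Hom(N, Q)) (f : 'Hom(M, N)) :
  g \in modhom N Q -> f \in modhom M N -> (g \o f)%VF \in modhom M Q.
Proof. by move=> /homP gC /homP fC; apply/homP=> a v; rewrite !comp_lfunE fC gC. Qed.
Lemma modhomD M N (f g : 'Hom(M, N)) :
  f \in modhom M N -> g \in modhom M N -> f + g \in modhom M N.
Proof. exact: memvD. Qed.
Lemma modhomB M N (f g : 'Hom(M, N)) :
  f \in modhom M N -> g \in modhom M N -> f - g \in modhom M N.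
Proof. exact: memvB. Qed.
Lemma modhom0 M N : 0 \in modhom M N.
Proof. exact: mem0v. Qed.
Lemma modhom_inv M N (f : 'Hom(M, N)) (g : 'Hom(N, M)) :
  f \in modhom M N -> cancel f g -> cancel g f -> g \in modhom N M.
Proof.
move=> /homP fC fK gK; apply/homP=> a v; apply: (can_inj fK).
by rewrite fC !gK.
Qed.

End ModuleTheory.

Section DirectSums.
Variables (k : fieldType) (C : falgType k).
Implicit Types (M N X Y Z P Q : fdmod C).

Definition dinl M N : 'Hom(M, dsum M N).
Proof.
by apply: (@hom_of k M (dsum M N) (fun v => (v, 0))) => c u v; congr pair; rewrite /= scaler0 addr0.
Defined.
Definition dinr M N : 'Hom(N, dsum M N).
Proof.
by apply: (@hom_of k N (dsum M N) (fun v => (0, v))) => c u v; congr pair; rewrite /= scaler0 addr0.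
Defined.
Definition dfst M N : 'Hom(dsum M N, M).
Proof. by apply: (@hom_of k (dsum M N) M fst) => c u v. Defined.
Definition dsnd M N : 'Hom(dsum M N, N).
Proof. by apply: (@hom_of k (dsum M N) N snd) => c u v. Defined.
Lemma dinlE M N v : dinl M N v = (v, 0). Proof. exact: hom_ofE. Qed.
Lemma dinrE M N v : dinr M N v = (0, v). Proof. exact: hom_ofE. Qed.
Lemma dfstE M N v : dfst M N v = v.1. Proof. exact: hom_ofE. Qed.
Lemma dsndE M N v : dsnd M N v = v.2. Proof. exact: hom_ofE. Qed.
Lemma dinl_modhom M N : dinl M N \in modhom M (dsum M N).
Proof. by apply/homP=> a v; rewrite !dinlE /= /dsum_act /= act0. Qed.
Lemma dinr_modhom M N : dinr M N \in modhom N (dsum M N).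
Proof. by apply/homP=> a v; rewrite !dinrE /= /dsum_act /= act0. Qed.
Lemma dfst_modhom M N : dfst M N \in modhom (dsum M N) M.
Proof. by apply/homP=> a v; rewrite !dfstE. Qed.
Lemma dsnd_modhom M N : dsnd M N \in modhom (dsum M N) N.
Proof. by apply/homP=> a v; rewrite !dsndE. Qed.

End DirectSums.

Section Submodules.
Variables (k : fieldType) (C : falgType k).
Implicit Types (M N X Y Z P Q : fdmod C).

Lemma dsum_split M N (v : dsum M N) :
  v = dinl M N (dfst M N v) + dinr M N (dsnd M N v).
Proof.
by case: v => x y; rewrite dinlE dinrE dfstE dsndE /=; congr pair; rewrite /= ?addr0 ?add0r.
Qed.

Section SubModule.
Variables (M : fdmod C) (U : {vspace M}) (US : submodule U).
Definition sub_act a (v : subvs_of U) := vsproj U (act a (vsval v)).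
Lemma sub_actE a v : vsval (sub_act a v) = act a (vsval v).
Proof. by rewrite vsprojK //; apply/US/subvsP. Qed.
Fact sub_act_linear a : linear (sub_act a).
Proof. by move=> c u v; rewrite /sub_act !linearP. Qed.
Fact sub_act_linearl v : linear (sub_act^~ v).
Proof. by move=> c a b; rewrite /sub_act act_linearl linearP. Qed.
Fact sub_act1 v : sub_act 1 v = v.
Proof. by rewrite /sub_act act1 vsvalK. Qed.
Fact sub_actM a b v : sub_act (a * b) v = sub_act a (sub_act b v).
Proof. by apply: subvs_inj; rewrite !sub_actE actM. Qed.
Definition submod : fdmod C :=
  FdMod sub_act_linear sub_act_linearl sub_act1 sub_actM.

Definition sub_incl : 'Hom(submod, M) := linfun (@vsval k M U).
Lemma sub_inclE v : sub_incl v = vsval v.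
Proof. by rewrite lfunE. Qed.
Lemma sub_incl_modhom : sub_incl \in modhom submod M.
Proof. by apply/homP=> a v; rewrite !sub_inclE sub_actE. Qed.
Lemma sub_corestrict N (f : 'Hom(N, M)) : f \in modhom N M ->
  (limg f <= U)%VS ->
  exists2 g : 'Hom(N, submod), g \in modhom N submod & forall x, vsval (g x) = f x.
Proof.
move=> /homP fC fU; have fUx x : f x \in U by apply/(subvP fU)/memv_img/memvf.
have gl : linear (fun x => vsproj U (f x) : submod).
  by move=> c u v; rewrite !linearP.
exists (hom_of gl); last by move=> x; rewrite hom_ofE vsprojK.
by apply: modhom_of => a v; apply: subvs_inj; rewrite sub_actE !vsprojK.
Qed.
End SubModule.

End Submodules.

Ltac modhom := lazymatch goal with
  | |- is_true (in_mem (_ \o _)%VF _) => apply: modhom_comp; modhom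
  | |- is_true (in_mem (_ - _) _) => apply: modhomB; modhom
  | |- is_true (in_mem (_ + _) _) => apply: modhomD; modhom
  | _ => first
    [ assumption | exact: modhom_id | exact: modhom0
    | exact: dinl_modhom | exact: dinr_modhom | exact: dfst_modhom
    | exact: dsnd_modhom | exact: sub_incl_modhom ]
  end.

Section Retracts.
Variables (k : fieldType) (C : falgType k).
Implicit Types (M N X Y Z P Q : fdmod C).

(** A direct summand without a chosen complement; [summandE] shows the agreement with [summand]. *)
Definition retract X M := exists (i : 'Hom(X, M)) (p : 'Hom(M, X)),
  [/\ i \in modhom X M, p \in modhom M X & cancel i p].

Lemma isoE M N : iso M N <-> exists (f : 'Hom(M, N)) (g : 'Hom(N, M)),
  [/\ f \in modhom M N, g \in modhom N M, cancel f g & cancel g f].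
Proof.
split=> [[f fC [g' fK gK]]|[f [g [fC gC fK gK]]]]; last first.
  by exists f => //; exists g.
have f0 : lker f == 0%VS by apply/lker0P/(can_inj fK).
have fV : cancel f^-1%VF f.
  by move=> y; apply: limg_lfunVK; rewrite -(gK y); apply/memv_img/memvf.
exists f, f^-1%VF; split=> //; last exact: lker0_lfunK.
by apply: modhom_inv fC _ fV; apply: lker0_lfunK.
Qed.

Lemma iso_refl M : iso M M.
Proof.
by apply/isoE; exists \1%VF, \1%VF; split=> [||x|x]; rewrite ?modhom_id ?id_lfunE.
Qed.
Lemma iso_sym M N : iso M N -> iso N M.
Proof. by case/isoE=> f [g [? ? ? ?]]; apply/isoE; exists g, f. Qed.
Lemma iso_trans M N Q : iso M N -> iso N Q -> iso M Q.
Proof.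
case/isoE=> f [g [? ? fK gK]] /isoE [f' [g' [? ? fK' gK']]].
apply/isoE; exists (f' \o f)%VF, (g \o g')%VF; split; try by modhom.
  by move=> x; rewrite !comp_lfunE fK' fK.
by move=> x; rewrite !comp_lfunE gK gK'.
Qed.
Lemma iso_retract M N : iso M N -> retract M N.
Proof. by case/isoE=> f [g [? ? fK gK]]; exists f, g. Qed.
Lemma retract_refl M : retract M M.
Proof. exact/iso_retract/iso_refl. Qed.
Lemma retract_trans M N Q : retract M N -> retract N Q -> retract M Q.
Proof.
case=> [i [p [? ? ipK]]] [j [q [? ? jqK]]].
exists (j \o i)%VF, (p \o q)%VF; split; try by modhom.
by move=> x; rewrite !comp_lfunE jqK ipK.
Qed.
Lemma retract_inl M N : retract M (dsum M N).
Proof.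
by exists (dinl M N), (dfst M N); split; [modhom | modhom | move=> x; rewrite dinlE dfstE].
Qed.
Lemma retract_inr M N : retract N (dsum M N).
Proof.
by exists (dinr M N), (dsnd M N); split; [modhom | modhom | move=> x; rewrite dinrE dsndE].
Qed.

Lemma zeroP M : zero M <-> forall x : M, x = 0.
Proof.
rewrite /zero; split=> [/eqP|x0].
  by rewrite dimv_eq0 => /eqP M0 x; apply/eqP; rewrite -memv0 -M0 memvf.
apply/eqP; rewrite dimv_eq0 -subv0; apply/subvP=> x _.
by rewrite (x0 x) mem0v.
Qed.

Lemma submodule_limg M N (f : 'Hom(M, N)) : f \in modhom M N -> submodule (limg f).
Proof.
move=> /homP fC a _ /memv_imgP[x _ ->]; rewrite -fC; exact/memv_img/memvf.
Qed.
Lemma submodule_lker M N (f : 'Hom(M, N)) : f \in modhom M N -> submodule (lker f).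
Proof.
by move=> /homP fC a x; rewrite !memv_ker fC => /eqP->; rewrite act0.
Qed.

Lemma iso_dsum_sub M (U V : {vspace M}) (US : submodule U) (VS : submodule V) :
  (U :&: V = 0)%VS -> (U + V)%VS = fullv -> iso M (dsum (submod US) (submod VS)).
Proof.
move=> UV0 UVT; apply: iso_sym.
pose f := ((sub_incl US \o dfst (submod US) (submod VS)) +
             (sub_incl VS \o dsnd (submod US) (submod VS)))%VF.
have fE v : f v = vsval v.1 + vsval v.2.
  by rewrite /f add_lfunE !comp_lfunE dfstE dsndE !sub_inclE.
have f_inj : injective f.
  apply/lker0P; rewrite -subv0; apply/subvP=> v; rewrite memv_ker fE memv0.
  rewrite addr_eq0 => /eqP E.
  have : vsval v.1 \in (U :&: V)%VS.
    by rewrite memv_cap subvsP E rpredN subvsP.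
  rewrite UV0 memv0 => /eqP v10; move: E; rewrite v10 => /eqP.
  rewrite eq_sym oppr_eq0 => /eqP v20.
  case: v v10 v20 => /= x y v10 v20.
  by apply/eqP; congr pair; apply: subvs_inj; first [exact: v10|exact: v20].
exists f; first by rewrite /f; modhom.
have fs y : y \in limg f.
  have : y \in (U + V)%VS by rewrite UVT memvf.
  case/memv_addP=> u uU [v vV ->].
  have -> : u + v = f ((vsproj U u, vsproj V v) : dsum (submod US) (submod VS)).
    by rewrite fE /= !vsprojK.
  exact/memv_img/memvf.
exists f^-1%VF; first by apply: lker0_lfunK; apply/lker0P.
by move=> y; apply: limg_lfunVK.
Qed.

(** The complement of a retract is the kernel of [p], onto which 1 - i p corestricts. *)
Lemma summandE X M : summand X M <-> retract X M.
Proof.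
split=> [[Y iM]|[i [p [iC pC ipK]]]].
  exact: retract_trans (retract_inl X Y) (iso_retract (iso_sym iM)).
have gC : (\1 - (i \o p))%VF \in modhom M M by modhom.
have gE y : (\1 - (i \o p))%VF y = y - i (p y).
  by rewrite add_lfunE opp_lfunE comp_lfunE id_lfunE.
have [|g gK gE'] := sub_corestrict (submodule_lker pC) gC.
  apply/subvP=> _ /memv_imgP[y _ ->].
  by rewrite memv_ker gE linearB /= ipK subrr.
pose K := submod (submodule_lker pC); exists K.
apply/isoE; exists ((dinl X K \o p) + (dinr X K \o g))%VF,
  ((i \o dfst X K) + (sub_incl _ \o dsnd X K))%VF; split; try by modhom.
  move=> y; rewrite !(add_lfunE, comp_lfunE) !(dinlE, dinrE, dfstE, dsndE) /=.
  by rewrite add0r addr0 sub_inclE gE' gE addrC subrK.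
move=> [x u]; rewrite !(add_lfunE, comp_lfunE) !(dinlE, dinrE, dfstE, dsndE) /=.
have pu : p (vsval u) = 0 by apply/eqP; rewrite -memv_ker subvsP.
rewrite sub_inclE; set y := i x + vsval u.
have py : p y = x by rewrite /y linearD /= ipK pu addr0.
congr pair; rewrite /= ?addr0 ?add0r //.
by apply: subvs_inj; rewrite gE' gE py /y addrC addKr.
Qed.
End Retracts.

(** * Fitting's lemma and the Krull-Schmidt property *)

Section Fitting.
Variables (k : fieldType) (C : falgType k).
Implicit Types (M N X Y Z P Q : fdmod C).

Definition lpow (V : vectType k) (f : 'End(V)) n : 'End(V) :=
  iter n (comp_lfun f) \1%VF.

Lemma lpowE (V : vectType k) (f : 'End(V)) n x : lpow f n x = iter n f x.
Proof. by elim: n => [|n IHn] /=; rewrite ?id_lfunE // comp_lfunE IHn. Qed.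

Lemma lpow_modhom M (f : 'End(M)) n : f \in modhom M M -> lpow f n \in modhom M M.
Proof. by move=> fC; elim: n => [|n IHn] /=; modhom. Qed.

Lemma dim_limg_le (U V : vectType k) (f : 'Hom(U, V)) (W : {vspace U}) :
  (\dim (f @: W) <= \dim W)%N.
Proof. by rewrite -(limg_ker_dim f W) leq_addl. Qed.

(** It suffices that g maps its image onto itself, by a dimension count. The exponent is kept
    positive so that a trivial kernel of g forces f to be injective. *)
Lemma fitting (V : vectType k) (f : 'End(V)) : exists n,
  let g := lpow f n.+1 in
  (limg g :&: lker g = 0)%VS /\ (limg g + lker g = fullv)%VS.
Proof.
suff [n dimE] : exists n,
    \dim (lpow f n.+1 @: limg (lpow f n.+1))%VS = \dim (limg (lpow f n.+1)).
  exists n; move: (lpow f n.+1) dimE => g dimE /=.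
  have I0 : (limg g :&: lker g = 0)%VS.
    apply/eqP; rewrite -dimv_eq0 -(eqn_add2r (\dim (g @: limg g))).
    by rewrite limg_ker_dim add0n dimE.
  split=> //; apply/eqP; rewrite eqEdim subvf dimv_disjoint_sum //.
  by rewrite -(limg_ker_dim g fullv) capfv addnC leqnn.
suff H d n : (\dim (limg (lpow f n.+1)) <= d)%N -> exists n,
    \dim (lpow f n.+1 @: limg (lpow f n.+1))%VS = \dim (limg (lpow f n.+1)).
  exact: (H _ 0%N (leqnn _)).
elim: d n => [|d IHd] n led.
  exists n; apply/eqP; rewrite eqn_leq (leq_trans _ (leq0n _)); last first.
    by apply: leq_trans (dim_limg_le _ _) led.
  by rewrite (leq_trans led).
have [eqd|ned] := eqVneq (\dim (lpow f n.+1 @: limg (lpow f n.+1))%VS)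
                         (\dim (limg (lpow f n.+1))); first by exists n.
(* The exponent doubles, (n.+1 + n).+1 being twice n.+1, so the new image is the image under g of
   the old one and has smaller dimension. *)
apply: (IHd (n.+1 + n)%N).
rewrite -ltnS; apply: leq_trans led; rewrite ltn_neqAle.
have -> : limg (lpow f (n.+1 + n).+1) = (lpow f n.+1 @: limg (lpow f n.+1))%VS.
  rewrite -limg_comp; congr (_ @: _)%VS; apply/lfunP=> x.
  by rewrite [LHS]lpowE comp_lfunE !lpowE -iterD addnS.
by rewrite ned dim_limg_le.
Qed.

Lemma zero_submod M (U : {vspace M}) (US : submodule U) :
  zero (submod US) -> U = 0%VS.
Proof.
move/zeroP=> z; apply/eqP; rewrite -subv0; apply/subvP=> u uU.
rewrite memv0 -(vsprojK uU); apply/eqP.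
by rewrite (z (vsproj U u)) linear0.
Qed.

(** One of the two Fitting summands vanishes: the image makes f nilpotent, the kernel makes it
    injective. *)
Lemma indec_endo X (f : 'End(X)) : indecomposable X -> f \in modhom X X ->
  injective f \/ exists n, forall x, iter n f x = 0.
Proof.
move=> [_ indX] fC; have [n] := fitting f; set g := lpow f n.+1 => -[g0 gT].
have gC : g \in modhom X X by apply: lpow_modhom.
have [z|z] := indX _ _ (iso_dsum_sub (submodule_limg gC) (submodule_lker gC) g0 gT).
  right; exists n.+1 => x; rewrite -lpowE -/g; apply/eqP.
  by rewrite -memv0 -(zero_submod z); apply/memv_img/memvf.
left; apply/lker0P; rewrite -subv0 -(zero_submod z); apply/subvP=> x.
rewrite !memv_ker lpowE iterSr => /eqP->; apply/eqP.
by elim: (n) => //= m ->; rewrite linear0.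
Qed.

Lemma endo_inv X (f : 'End(X)) : f \in modhom X X -> injective f ->
  exists g : 'End(X), [/\ g \in modhom X X, cancel f g & cancel g f].
Proof.
move=> fC /lker0P f0; exists f^-1%VF.
have K := lker0_lfunK f0; have K' := lker0_lfunVK f0.
by split=> //; apply: modhom_inv fC K K'.
Qed.

(** This is the locality of End X. If f is nilpotent, then g x = 0 gives x = f x, hence x = f^n x =
    0. *)
Lemma indec_local X (f g : 'End(X)) : indecomposable X ->
  f \in modhom X X -> (forall x, f x + g x = x) -> injective f \/ injective g.
Proof.
move=> iX fC fg; have [|[n fn]] := indec_endo iX fC; first by left.
right; apply/lker0P; rewrite -subv0; apply/subvP=> x.
rewrite memv_ker memv0 => /eqP gx; apply/eqP; rewrite -(fn x).
have fx : f x = x by rewrite -{2}(fg x) gx addr0.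
by elim: (n) => //= m <-.
Qed.

Lemma retract_inj X M (i : 'Hom(X, M)) (p : 'Hom(M, X)) :
  i \in modhom X M -> p \in modhom M X -> injective (p \o i)%VF -> retract X M.
Proof.
move=> iC pC /endo_inv[|g [gC gK _]]; first by modhom.
exists i, (g \o p)%VF; split; [done | by modhom | move=> x].
by rewrite comp_lfunE -[RHS]gK comp_lfunE.
Qed.

(** The identity of Y is the sum of its parts through M and through N, one of which is
    invertible. *)
Lemma indec_retract_dsum Y M N : indecomposable Y -> retract Y (dsum M N) ->
  retract Y M \/ retract Y N.
Proof.
move=> iY [i [p [iC pC ipK]]].
pose f := ((p \o dinl M N) \o (dfst M N \o i))%VF.
pose g := ((p \o dinr M N) \o (dsnd M N \o i))%VF.
have [||fi|gi] := @indec_local _ f g iY.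
- by rewrite /f; modhom.
- by move=> x; rewrite !comp_lfunE -(linearD p) -dsum_split; apply: ipK.
- by left; apply: retract_inj fi; modhom.
- by right; apply: retract_inj gi; modhom.
Qed.

(** With a : X -> Z and b : Z -> X the components through Z, the endomorphism a b is nilpotent, as
    otherwise Z would split off X. Then b a is nilpotent too, and 1 - b a, the part of the identity
    that passes through M, is injective. *)
Lemma retract_absorb X M Z : indecomposable Z -> ~ retract Z X ->
  retract X (dsum M Z) -> retract X M.
Proof.
move=> iZ nZX [i [p [iC pC ipK]]].
pose a := (dsnd M Z \o i)%VF; pose b := (p \o dinr M Z)%VF.
have aC : a \in modhom X Z by rewrite /a; modhom.
have bC : b \in modhom Z X by rewrite /b; modhom.
have [abi|[n abn]] := @indec_endo _ (a \o b)%VF iZ ltac:(by modhom).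
  by case: nZX; apply: retract_inj abi.
apply: (@retract_inj _ _ (dfst M Z \o i)%VF (p \o dinl M Z)%VF); try by modhom.
apply/lker0P; rewrite -subv0; apply/subvP=> x.
rewrite memv_ker memv0 !comp_lfunE => /eqP x0.
have xE : b (a x) = x.
  by rewrite -[RHS]ipK (dsum_split (i x)) linearD /= x0 add0r !comp_lfunE.
have ax0 : a x = 0.
  by rewrite -(abn (a x)); elim: (n) => //= m <-; rewrite comp_lfunE xE.
by rewrite -xE ax0 linear0.
Qed.

(** The idempotent i p of X is injective, hence the identity, or nilpotent, which would force Z =
    0. *)
Lemma retract_indec_iso Z X : ~ zero Z -> indecomposable X -> retract Z X ->
  iso Z X.
Proof.
move=> nZ iX [i [p [iC pC ipK]]].
have [ei|[n en]] := @indec_endo _ (i \o p)%VF iX ltac:(by modhom).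
  apply/isoE; exists i, p; split=> // x.
  by apply: ei; rewrite !comp_lfunE ipK.
case: nZ; apply/zeroP=> z; rewrite -(ipK z).
suff -> : i z = 0 by rewrite linear0.
rewrite -(en (i z)); elim: (n) => //= m <-.
by rewrite comp_lfunE ipK.
Qed.

Lemma indec_nzero Z : indecomposable Z -> ~ zero Z.
Proof. by case. Qed.

Definition dmap M N X Y (f : 'Hom(M, X)) (g : 'Hom(N, Y)) : 'Hom(dsum M N, dsum X Y) :=
  ((dinl X Y \o (f \o dfst M N)) + (dinr X Y \o (g \o dsnd M N)))%VF.
Lemma dmapE M N X Y (f : 'Hom(M, X)) (g : 'Hom(N, Y)) v :
  dmap f g v = (f v.1, g v.2).
Proof.
rewrite add_lfunE !comp_lfunE dinlE dinrE dfstE dsndE.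
by congr pair; rewrite /= ?addr0 ?add0r.
Qed.
Lemma dmap_modhom M N X Y (f : 'Hom(M, X)) (g : 'Hom(N, Y)) :
  f \in modhom M X -> g \in modhom N Y ->
  dmap f g \in modhom (dsum M N) (dsum X Y).
Proof. by move=> fC gC; rewrite /dmap; modhom. Qed.

Lemma retract_dsum M N X Y : retract M X -> retract N Y ->
  retract (dsum M N) (dsum X Y).
Proof.
move=> [i [p [iC pC ip]]] [j [q [jC qC jq]]].
exists (dmap i j), (dmap p q); split; try exact: dmap_modhom.
by case=> u v; rewrite !dmapE /= ip jq.
Qed.

Lemma iso_dsum M N X Y : iso M X -> iso N Y -> iso (dsum M N) (dsum X Y).
Proof.
move=> /isoE[i [p [iC pC ip pi]]] /isoE[j [q [jC qC jq qj]]].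
apply/isoE; exists (dmap i j), (dmap p q); split; try exact: dmap_modhom.
  by case=> u v; rewrite !dmapE /= ip jq.
by case=> u v; rewrite !dmapE /= pi qj.
Qed.

Lemma iso_dsumC M N : iso (dsum M N) (dsum N M).
Proof.
have E A B : (dinl B A \o dsnd A B + (dinr B A \o dfst A B))%VF
    \in modhom (dsum A B) (dsum B A) by modhom.
have K A B (v : dsum A B) :
    ((dinl B A \o dsnd A B) + (dinr B A \o dfst A B))%VF v = (v.2, v.1).
  rewrite add_lfunE !comp_lfunE dinlE dinrE dfstE dsndE.
  by congr pair; rewrite /= ?addr0 ?add0r.
by apply/isoE; do 2![eexists]; split; try exact: E; case=> u v; rewrite !K.
Qed.

Lemma iso_dsum0 N Y : zero Y -> iso N (dsum N Y).
Proof.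
move/zeroP=> Y0; apply/isoE; exists (dinl N Y), (dfst N Y); split; try by modhom.
  by move=> x; rewrite dinlE dfstE.
by case=> x y; rewrite dinlE dfstE (Y0 y).
Qed.

Lemma basicE M : basic M <-> forall X Y, indecomposable X -> indecomposable Y ->
  retract (dsum X Y) M -> ~ iso X Y.
Proof. by split=> bM X Y iX iY /summandE; apply: bM. Qed.

Lemma basic_retract M N : basic M -> retract N M -> basic N.
Proof.
move=> /basicE bM NM; apply/basicE=> X Y iX iY rXY.
exact: bM iX iY (retract_trans rXY NM).
Qed.

(* Otherwise no map Z -> M -> Z is invertible, and the identity of Z (+) Z
   would be, modulo the radical of End Z, a matrix of rank one. *)
Lemma retract_sqr M Z : indecomposable Z -> retract (dsum Z Z) (dsum M Z) -> retract Z M.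
Proof.
move=> iZ [i [p [iC pC ipK]]]; apply: NNPP => nZM.
pose ia (s : bool) := if s then dinl Z Z else dinr Z Z.
pose pa (s : bool) := if s then dfst Z Z else dsnd Z Z.
have iaC s : ia s \in modhom Z (dsum Z Z) by rewrite /ia; case: s; modhom.
have paC s : pa s \in modhom (dsum Z Z) Z by rewrite /pa; case: s; modhom.
pose c s := (dsnd M Z \o (i \o ia s))%VF : 'End(Z).
pose d s := (pa s \o (p \o dinr M Z))%VF : 'End(Z).
have cC s : c s \in modhom Z Z by rewrite /c; have ? := iaC s; modhom.
have dC s : d s \in modhom Z Z by rewrite /d; have ? := paC s; modhom.
(* Entry (s, t) of the identity matrix of Z (+) Z is the sum of [m s t], its part through M, and of
   [d s \o c t], its part through the extra Z. *)
pose m s t := ((pa s \o (p \o dinl M Z)) \o (dfst M Z \o (i \o ia t)))%VF : 'End(Z).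
have mC s t : m s t \in modhom Z Z by rewrite /m; have ? := iaC t; have ? := paC s; modhom.
have mN s t : ~ injective (m s t).
  by move=> /retract_inj mi; apply/nZM/mi; have ? := iaC t; have ? := paC s; modhom.
have mE s t x : m s t x + d s (c t x) = (s == t)%:R *: x.
  rewrite !comp_lfunE; set w := i (ia t x).
  have -> : pa s (p (dinl M Z (dfst M Z w))) + pa s (p (dinr M Z (dsnd M Z w)))
      = pa s (p w) by rewrite [in RHS](dsum_split w) !linearD.
  rewrite {}/w ipK.
  by case: s t => [] [] /=; rewrite ?dinlE ?dinrE ?dfstE ?dsndE ?scale1r ?scale0r.
have inj_dc s : injective (d s \o c s)%VF.
  have [||//] := @indec_local _ (m s s) (d s \o c s)%VF iZ (mC s s).
    by move=> x; rewrite comp_lfunE mE eqxx scale1r.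
  by move/mN.
have c_inj s : injective (c s).
  by move=> x y cxy; apply: (inj_dc s); rewrite [LHS]comp_lfunE cxy [RHS]comp_lfunE.
have d_inj s : injective (d s).
  have [g [gC gK Kg]] := endo_inv (cC s) (@c_inj s).
  move=> x y dxy; rewrite -(Kg x) -(Kg y); congr (c s _).
  by apply: (inj_dc s); rewrite [LHS]comp_lfunE [RHS]comp_lfunE !Kg.
(* Off the diagonal the entry is zero, so [m] is minus the injective map [d true \o c false],
   although no map through M is injective. *)
apply: (mN true false); apply/lker0P; rewrite -subv0; apply/subvP=> x.
rewrite memv_ker memv0 => /eqP mx0.
have := mE true false x; rewrite mx0 add0r scale0r => dc0.
by apply/eqP/(@c_inj false)/(@d_inj true); rewrite dc0 !linear0.
Qed.

(** A repeated summand X (+) Y not involving Z would be absorbed into M. Otherwise X and Y are both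
    copies of Z, and [retract_sqr] makes Z a summand of M. *)
Lemma basic_dsum M Z : basic M -> indecomposable Z -> ~ retract Z M ->
  basic (dsum M Z).
Proof.
move=> /basicE bM iZ nZM; apply/basicE=> X Y iX iY rXY isoXY.
have isoC W : indecomposable W -> retract Z W -> iso Z W.
  by move=> iW; apply: retract_indec_iso => //; apply: indec_nzero.
have [rZ|nZ] := classic (retract Z (dsum X Y)); last first.
  exact: bM iX iY (retract_absorb iZ nZ rXY) isoXY.
have [ZX ZY] : iso Z X /\ iso Z Y.
  have [/(isoC _ iX) ZX|/(isoC _ iY) ZY] := indec_retract_dsum iZ rZ.
    by split=> //; apply: iso_trans isoXY.
  by split=> //; apply: iso_trans ZY (iso_sym isoXY).
apply/nZM/(retract_sqr iZ)/(retract_trans _ rXY)/iso_retract.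
exact: iso_dsum.
Qed.
End Fitting.

(** * The number of indecomposable summands *)

Section Counting.
Variables (k : fieldType) (C : falgType k).
Implicit Types (M N X Y Z P Q : fdmod C).

Lemma iso_dim M N : iso M N -> \dim {:M} = \dim {:N}.
Proof.
have le A B : iso A B -> (\dim {:A} <= \dim {:B})%N.
  case/isoE=> f [g [_ _ fK gK]]; have /lker0P/eqP f0 := can_inj fK.
  by rewrite -(@limg_dim_eq _ _ _ f fullv) ?f0 ?capv0 // dimvS // subvf.
by move=> MN; apply/eqP; rewrite eqn_leq !le //; apply: iso_sym.
Qed.

Lemma dsum_dim M N : \dim {:dsum M N} = (\dim {:M} + \dim {:N})%N.
Proof. by rewrite !dimvf. Qed.

Lemma indec_exists M : ~ zero M -> exists2 Z, indecomposable Z & retract Z M.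
Proof.
have [d] := ubnP (\dim {:M}); elim: d M => // d IHd M ltMd nM.
have [iM|niM] := classic (indecomposable M).
  by exists M => //; apply: retract_refl.
have [X [Y [isoM nX nY]]] : exists X Y, [/\ iso M (dsum X Y), ~ zero X & ~ zero Y].
  apply: NNPP => H; apply: niM; split=> // X Y isoM.
  have [|nX] := classic (zero X); first by left.
  by right; apply: NNPP => nY; case: H; exists X, Y.
have [|Z iZ ZX] := IHd X _ nX.
  move: ltMd; rewrite (iso_dim isoM) dsum_dim ltnS; apply: leq_trans.
  by rewrite -addn1 leq_add2l lt0n; apply/eqP.
exists Z => //; apply: retract_trans ZX _.
exact: retract_trans (retract_inl X Y) (iso_retract (iso_sym isoM)).
Qed.

Lemma num_summandsE M n : num_summands M n <-> exists X : 'I_n -> fdmod C,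
    [/\ forall i, indecomposable (X i) /\ retract (X i) M,
        forall i j, iso (X i) (X j) -> i = j
      & forall Y, indecomposable Y -> retract Y M -> exists i, iso Y (X i)].
Proof.
split=> -[X [Xi Xinj Xs]]; exists X; split=> //.
- by move=> i; have [iX /summandE] := Xi i.
- by move=> Y iY /summandE; apply: Xs.
- by move=> i; have [iX /summandE] := Xi i.
- by move=> Y iY /summandE; apply: Xs.
Qed.

Lemma num_inj m n (X : 'I_m -> fdmod C) (Y : 'I_n -> fdmod C) :
  (forall i j, iso (X i) (X j) -> i = j) -> (forall i, exists j, iso (X i) (Y j)) ->
  exists2 f : 'I_m -> 'I_n, injective f & forall i, iso (X i) (Y (f i)).
Proof.
move=> Xinj /fin_all_exists[f fE]; exists f => // i j fij; apply: Xinj.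
by apply: iso_trans (fE i) (iso_sym _); rewrite fij.
Qed.

Lemma num_retract_le M N m n : retract N M -> num_summands N m -> num_summands M n ->
  (m <= n)%N.
Proof.
move=> NM /num_summandsE[X [Xi Xinj _]] /num_summandsE[Y [_ _ Ys]].
have [|f f_inj _] := num_inj (Y := Y) Xinj.
  by move=> i; have [iX XN] := Xi i; apply: Ys iX (retract_trans XN NM).
by have := leq_card _ f_inj; rewrite !card_ord.
Qed.

Lemma num_unique M m n : num_summands M m -> num_summands M n -> m = n.
Proof.
move=> Mm Mn; apply/eqP.
by rewrite eqn_leq !(@num_retract_le M M) //; apply: retract_refl.
Qed.

Lemma num_same M N n :
  (forall Y, indecomposable Y -> retract Y M <-> retract Y N) ->
  num_summands M n -> num_summands N n.
Proof.
move=> MN /num_summandsE[X [Xi Xinj Xs]]; apply/num_summandsE; exists X; split=> //.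
  by move=> i; have [iX XM] := Xi i; split=> //; apply/MN.
by move=> Y iY /(MN Y iY); apply: Xs.
Qed.

Lemma num_iso M N n : iso M N -> num_summands M n -> num_summands N n.
Proof.
move=> MN; apply: num_same => Y _; split=> YM; apply: retract_trans YM _.
  exact: iso_retract.
exact/iso_retract/iso_sym.
Qed.

Lemma num_dsum M Z n : num_summands M n -> indecomposable Z -> ~ retract Z M ->
  num_summands (dsum M Z) n.+1.
Proof.
move=> /num_summandsE[X [Xi Xinj Xs]] iZ nZM; apply/num_summandsE.
pose X' (i : 'I_n.+1) := if unlift ord_max i is Some j then X j else Z.
have nXZ i : ~ iso Z (X i).
  by move=> /iso_retract ZX; apply/nZM/(retract_trans ZX); case: (Xi i).
exists X'; split.
- move=> i; rewrite /X'; case: unliftP => [j _|_].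
    by have [iX XM] := Xi j; split=> //; apply: retract_trans XM (retract_inl _ _).
  by split=> //; apply: retract_inr.
- move=> i j; rewrite /X'; case: unliftP => [i' ->|->]; case: unliftP => [j' ->|->] //.
  + by move/Xinj->.
  + by move/iso_sym/nXZ.
  + by move/nXZ.
- move=> Y iY /(indec_retract_dsum iY)[YM|YZ].
    have [i Yi] := Xs Y iY YM.
    by exists (lift ord_max i); rewrite /X' liftK.
  exists ord_max; rewrite /X' unlift_none.
  by apply: retract_indec_iso => //; apply: indec_nzero.
Qed.

Lemma num_exists M : exists n, num_summands M n.
Proof.
have [d] := ubnP (\dim {:M}); elim: d M => // d IHd M ltMd.
have [z|nz] := classic (zero M).
  (* The family is indexed by the empty type; its value is a placeholder. *)
  exists 0%N; apply/num_summandsE; exists (fun=> M); split=> // [[]//|[]//|].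
  move=> Y [nY _] [i [p [_ _ ip]]]; case: nY; apply/zeroP=> y; rewrite -(ip y).
  by rewrite (proj1 (zeroP M) z (i y)) linear0.
have [Z iZ /summandE[Y isoM]] := indec_exists nz.
have isoM' : iso (dsum Y Z) M by apply: iso_trans (iso_dsumC _ _) (iso_sym isoM).
have [|n Yn] := IHd Y.
  move: ltMd; rewrite (iso_dim isoM) dsum_dim ltnS; apply: leq_trans.
  by rewrite -add1n leq_add2r lt0n; apply/eqP; apply: indec_nzero iZ.
have [ZY|nZY] := classic (retract Z Y); last first.
  by exists n.+1; apply: num_iso isoM' _; apply: num_dsum.
exists n; apply: num_iso isoM' _; apply: num_same Yn => X iX.
split=> [XY|/(indec_retract_dsum iX)[//|XZ]].
  exact: retract_trans XY (retract_inl _ _).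
exact: retract_trans XZ ZY.
Qed.

(** A nonzero complement of N would have an indecomposable summand Z. The n classes of summands of N
    exhaust those of M, so Z is also a summand of N, and Z (+) Z would be one of the basic module
    M. *)
Lemma basic_num_iso M N n : basic M -> retract N M ->
  num_summands N n -> num_summands M n -> iso N M.
Proof.
move=> /basicE bM /summandE[Y isoM] /num_summandsE[X [Xi Xinj _]] /num_summandsE[W [Wi _ Ws]].
have [z|nz] := classic (zero Y).
  by apply: iso_trans (iso_sym isoM); apply: iso_dsum0.
have MS : retract (dsum N Y) M := iso_retract (iso_sym isoM).
have [f f_inj fE] : exists2 f : 'I_n -> 'I_n, injective f & forall i, iso (X i) (W (f i)).
  apply: num_inj => // i; have [iX XN] := Xi i; apply: Ws => //.
  exact: retract_trans XN (retract_trans (retract_inl _ _) MS).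
have [Z iZ ZY] := indec_exists nz.
have [j Zj] := Ws Z iZ (retract_trans ZY (retract_trans (retract_inr _ _) MS)).
have [g _ fg] := injF_bij f_inj.
have ZN : retract Z N.
  apply: retract_trans (iso_retract Zj) _; rewrite -(fg j).
  apply: retract_trans (iso_retract (iso_sym (fE _))) _.
  by case: (Xi (g j)).
case: (bM Z Z iZ iZ _ (iso_refl Z)); apply: retract_trans MS.
exact: retract_dsum.
Qed.
End Counting.

(** * Factor modules and traces *)

Section Factors.
Variables (k : fieldType) (C : falgType k).
Implicit Types (M N X Y Z P Q : fdmod C).

Definition pinj n M (i : 'I_n) : 'Hom(M, pow n M).
Proof.
apply: (@hom_of k M (pow n M) (fun v => [ffun j => if j == i then v else 0])).
by move=> c u v; apply/ffunP=> j; rewrite !ffunE; case: eqP; rewrite ?scaler0 ?addr0.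
Defined.
Definition pproj n M (i : 'I_n) : 'Hom(pow n M, M).
Proof.
apply: (@hom_of k (pow n M) M (fun v => v i)).
by move=> c u v; rewrite !ffunE.
Defined.
Lemma pinjE n M (i : 'I_n) v j : pinj M i v j = if j == i then v else 0.
Proof. by rewrite hom_ofE ffunE. Qed.
Lemma pprojE n M (i : 'I_n) v : pproj M i v = v i.
Proof. exact: hom_ofE. Qed.
Lemma pinj_modhom n M (i : 'I_n) : pinj M i \in modhom M (pow n M).
Proof.
apply/homP=> a v; apply/ffunP=> j; rewrite pinjE ffunE pinjE.
by case: eqP; rewrite ?act0.
Qed.
Lemma pproj_modhom n M (i : 'I_n) : pproj M i \in modhom (pow n M) M.
Proof. by apply/homP=> a v; rewrite !pprojE ffunE. Qed.
Lemma pow_sum n M (v : pow n M) : v = \sum_i pinj M i (pproj M i v).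
Proof.
apply/ffunP=> j; rewrite sum_ffunE (bigD1 j) //= pinjE eqxx pprojE big1 ?addr0 //.
by move=> i /negPf ne; rewrite pinjE eq_sym ne.
Qed.

Lemma fullv_mem (V : vectType k) (W : {vspace V}) :
  (forall x, x \in W) -> W = fullv.
Proof. by move=> H; apply/vspaceP=> x; rewrite H memvf. Qed.

(** X is generated by M iff the images of all homomorphisms M -> X span X. This form avoids powers
    of M, and W may be any subspace. *)
Lemma FacE M X : Fac M X <-> forall W : {vspace X},
  (forall h : 'Hom(M, X), h \in modhom M X -> (limg h <= W)%VS) -> W = fullv.
Proof.
split=> [[n [f fC fT]] W hW|H].
  apply: fullv_mem => x.
  have /memv_imgP[v _ ->] : x \in limg f by rewrite fT memvf.
  rewrite (pow_sum v) linear_sum; apply: memv_suml => i _ /=.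
  have -> : f (pinj M i (pproj M i v)) = (f \o pinj M i)%VF (pproj M i v).
    by rewrite comp_lfunE.
  apply/(subvP (hW (f \o pinj M i)%VF _))/memv_img/memvf.
  exact: modhom_comp fC (pinj_modhom _ _).
(* The universal map M^n -> X has the members of a basis of Hom(M, X) as components. *)
pose b := vbasis (modhom M X); pose n := \dim (modhom M X).
pose F (v : pow n M) : X := \sum_(i < n) b`_i (v i).
have Fl : linear F.
  move=> c u v; rewrite /F scaler_sumr -big_split; apply: eq_bigr => i _.
  by rewrite !ffunE linearP.
have bC (i : 'I_n) : b`_i \in modhom M X by apply/vbasis_mem/mem_nth; rewrite size_tuple.
exists n, (hom_of Fl).
  apply: modhom_of => a v; rewrite /F act_sum; apply: eq_bigr => i _.
  by rewrite ffunE (modhomE (bC i)).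
apply: H => h hC; apply/subvP=> _ /memv_imgP[m _ ->].
have E : (h m) = \sum_(i < n) coord b i h *: b`_i m.
  by rewrite {1}(coord_vbasis hC) sum_lfunE; apply: eq_bigr => i _; rewrite scale_lfunE.
rewrite E; apply: memv_suml => i _; apply: memvZ; apply/memv_imgP.
exists (pinj M i m); rewrite ?memvf // hom_ofE /F (bigD1 i) //= pinjE eqxx big1 ?addr0 //.
by move=> j /negPf ne; rewrite pinjE ne linear0.
Qed.

Lemma Fac_refl M : Fac M M.
Proof.
apply/FacE=> W /(_ _ (modhom_id M)); rewrite lim1g => fW.
by apply: fullv_mem => x; rewrite (subvP fW) ?memvf.
Qed.

Lemma Fac_trans M N X : Fac M N -> Fac N X -> Fac M X.
Proof.
move=> /FacE MN /FacE NX; apply/FacE=> W hW; apply: NX => g gC.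
apply/subvP=> _ /memv_imgP[x _ ->]; rewrite memv_preim.
rewrite [(g @^-1: W)%VS](MN _) ?memvf // => h hC.
apply/subvP=> _ /memv_imgP[m _ ->]; rewrite -memv_preim.
rewrite -comp_lfunE; apply/(subvP (hW _ _))/memv_img/memvf.
exact: modhom_comp gC hC.
Qed.
End Factors.

(** * Projective modules and presentations *)

Section Projectives.
Variables (k : fieldType) (C : falgType k).
Implicit Types (M N X Y Z P Q R : fdmod C).

Lemma limg_surj (U V : vectType k) (f : 'Hom(U, V)) :
  limg f = fullv <-> forall y, exists x, y = f x.
Proof.
split=> [fT y|H].
  have /memv_imgP[x _ ->] : y \in limg f by rewrite fT memvf.
  by exists x.
by apply: fullv_mem => y; have [x ->] := H y; apply/memv_img/memvf.
Qed.

(** Lifting along g when only the values of h lie in its image: Y is replaced by the submodule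
    [limg g]. *)
Lemma proj_lift P X Y (g : 'Hom(X, Y)) (h : 'Hom(P, Y)) : projective P ->
  g \in modhom X Y -> h \in modhom P Y -> (forall x, exists y, h x = g y) ->
  exists2 s : 'Hom(P, X), s \in modhom P X & forall x, g (s x) = h x.
Proof.
move=> pP gC hC hg.
have S := submodule_limg gC.
have [g' g'C g'E] := sub_corestrict S gC (subvv _).
have [|h' h'C h'E] := sub_corestrict S hC.
  by apply/subvP=> _ /memv_imgP[x _ ->]; have [y ->] := hg x; apply/memv_img/memvf.
have [|s sC sE] := pP _ _ g' h' g'C _ h'C.
  apply/limg_surj => y; have /memv_imgP[x _ yE] := subvsP y.
  by exists x; apply: subvs_inj; rewrite g'E.
by exists s => // x; rewrite -g'E -h'E -sE comp_lfunE.
Qed.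

Lemma proj_retract M N : projective M -> retract N M -> projective N.
Proof.
move=> pM [i [p [iC pC ip]]] X Y g h gC gT hC.
have [s sC sE] := pM X Y g (h \o p)%VF gC gT (modhom_comp hC pC).
exists (s \o i)%VF; first by modhom.
by rewrite comp_lfunA sE; apply/lfunP=> x; rewrite !comp_lfunE ip.
Qed.

Lemma proj_regular : projective (regular C).
Proof.
move=> X Y g h gC gT hC.
have [x0 x0E] := proj1 (limg_surj g) gT (h (1 : C)).
have sl : linear (fun a : regular C => act (a : C) x0) by apply: act_linearl.
exists (hom_of sl); first by apply: modhom_of => a v; rewrite -actM.
apply/lfunP=> a; rewrite comp_lfunE hom_ofE (modhomE gC) -x0E -(modhomE hC) /=.
by rewrite /reg_act mulr1.
Qed.

Lemma proj_dsum P Q : projective P -> projective Q -> projective (dsum P Q).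
Proof.
move=> pP pQ X Y g h gC gT hC.
have [s sC sE] := pP X Y g (h \o dinl P Q)%VF gC gT ltac:(by modhom).
have [t tC tE] := pQ X Y g (h \o dinr P Q)%VF gC gT ltac:(by modhom).
exists ((s \o dfst P Q) + (t \o dsnd P Q))%VF; first by modhom.
rewrite comp_lfunDr !comp_lfunA sE tE -!comp_lfunA -comp_lfunDr.
apply/lfunP=> v; rewrite comp_lfunE; congr (h _).
by rewrite add_lfunE !comp_lfunE -dsum_split.
Qed.

Lemma proj_pow n P : projective P -> projective (pow n P).
Proof.
move=> pP X Y g h gC gT hC.
have H (i : 'I_n) : exists2 s : 'Hom(P, X), s \in modhom P X & (g \o s)%VF = (h \o pinj P i)%VF.
  by apply: pP => //; apply: modhom_comp hC (pinj_modhom _ _).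
have [s sC sE] := fin_all_exists2 H.
exists (\sum_i (s i \o pproj P i)%VF).
  by apply: memv_suml => i _; apply: modhom_comp (sC i) (pproj_modhom _ _).
apply/lfunP=> v; rewrite comp_lfunE sum_lfunE linear_sum [in RHS](pow_sum v) linear_sum.
apply: eq_bigr => i _; rewrite comp_lfunE /=.
by rewrite -[LHS]comp_lfunE sE comp_lfunE.
Qed.

Lemma free_cover M : exists n (f : 'Hom(pow n (regular C), M)),
  f \in modhom (pow n (regular C)) M /\ limg f = fullv.
Proof.
pose b := vbasis {:M}; pose n := \dim {:M}.
pose F (v : pow n (regular C)) : M := \sum_(i < n) act (v i : C) b`_i.
have Fl : linear F.
  move=> c u v; rewrite /F scaler_sumr -big_split; apply: eq_bigr => i _.
  by rewrite !ffunE /= act_linearl.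
exists n, (hom_of Fl); split.
  apply: modhom_of => a v; rewrite /F act_sum; apply: eq_bigr => i _.
  by rewrite ffunE -actM.
apply/limg_surj=> m; exists [ffun i : 'I_n => coord b i m *: (1 : C)].
rewrite hom_ofE /F {1}(coord_vbasis (memvf m)); apply: eq_bigr => i _.
by rewrite ffunE actZl act1.
Qed.

(** The e_i are the images of the unit vectors under a free cover, the g_i the coordinates of a
    section of it. *)
Lemma dual_basis P : projective P -> exists n (e : 'I_n -> P) (g : 'I_n -> 'Hom(P, regular C)),
  (forall i, g i \in modhom P (regular C)) /\
  forall p, p = \sum_i act (g i p : C) (e i).
Proof.
move=> pP; have [n [f [fC fT]]] := free_cover P.
have [s sC sE] := pP _ _ f \1%VF fC fT (modhom_id P).
exists n, (fun i => f (pinj (regular C) i (1 : C))), (fun i => pproj (regular C) i \o s)%VF.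
split=> [i|p]; first exact: modhom_comp (pproj_modhom _ _) sC.
have {1}-> : p = f (s p) by rewrite -comp_lfunE sE id_lfunE.
rewrite (pow_sum (s p)) linear_sum; apply: eq_bigr => i _ /=.
rewrite comp_lfunE -(modhomE fC) -(modhomE (pinj_modhom _ _)) /=.
by rewrite /reg_act mulr1.
Qed.

(* Among the projectives mapping onto M one of least dimension is a cover. *)
Lemma proj_cover M : exists P (g : 'Hom(P, M)),
  [/\ projective P, g \in modhom P M, limg g = fullv & superfluous (lker g)].
Proof.
have [n [f0 [f0C f0T]]] := free_cover M.
have [d] := ubnP (\dim {:pow n (regular C)}).
have := @proj_pow n _ proj_regular; move: (pow n (regular C)) f0 f0C f0T.
elim: d => // d IHd P g gC gT pP ltPd.
have [sP|/not_all_ex_not[W /not_all_ex_not[WS nW]]] := classic (superfluous (lker g)).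
  by exists P, g.
have [gWT {}nW] := imply_to_and _ _ nW.
have gWC : (g \o sub_incl WS)%VF \in modhom (submod WS) M by modhom.
have [|h0 h0C h0E] := pP (submod WS) M (g \o sub_incl WS)%VF g gWC _ gC.
  apply/limg_surj=> y; have [x ->] := proj1 (limg_surj g) gT y.
  have /memv_addP[u + [w wW ->]] : x \in (lker g + W)%VS by rewrite gWT memvf.
  rewrite memv_ker => /eqP u0; exists (vsproj W w).
  by rewrite comp_lfunE sub_inclE vsprojK // linearD /= u0 add0r.
(* A proper W with ker g + W = P already maps onto M, so g lifts to an endomorphism h with values in
   W and g h = g. The image of a Fitting power of h is a summand of P inside W that still maps onto
   M, and it is smaller than P. *)
pose h := (sub_incl WS \o h0)%VF : 'End(P).
have hC : h \in modhom P P by rewrite /h; modhom.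
have hE x : g (h x) = g x by rewrite -{2}h0E !comp_lfunE.
have [m] := fitting h; set q := lpow h m.+1 => -[q0 qT].
have qC : q \in modhom P P by apply: lpow_modhom.
have qE x : g (q x) = g x.
  by rewrite lpowE; elim: (m.+1) => //= j; rewrite hE.
have QS := submodule_limg qC.
have rQ : retract (submod QS) P.
  apply/summandE; exists (submod (submodule_lker qC)).
  exact: iso_dsum_sub.
apply: (IHd (submod QS) (g \o sub_incl QS)%VF).
- by modhom.
- apply/limg_surj=> y; have [x ->] := proj1 (limg_surj g) gT y.
  exists (vsproj (limg q) (q x)).
  by rewrite comp_lfunE sub_inclE vsprojK ?qE //; apply/memv_img/memvf.
- exact: proj_retract pP rQ.
have -> : \dim {:submod QS} = \dim (limg q) by rewrite dimvf.
rewrite -ltnS; apply: leq_trans ltPd; rewrite ltnS.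
have qW : (limg q <= W)%VS.
  apply/subvP=> _ /memv_imgP[x _ ->]; rewrite /q /= comp_lfunE /h comp_lfunE.
  by rewrite sub_inclE subvsP.
rewrite ltnNge; apply/negP=> le; apply: nW; apply/eqP.
rewrite eqEdim subvf (leq_trans le) ?dimvS //.
Qed.

(** [g] need not be a projective cover; this generality serves the presentation of M used for E M
    (+) S. *)
Lemma kernel_cover P M (g : 'Hom(P, M)) : g \in modhom P M ->
  exists R (f : 'Hom(R, P)), [/\ projective R, f \in modhom R P,
     limg f = lker g & superfluous (lker f)].
Proof.
move=> gC; have [R [f [pR fC fT sf]]] := proj_cover (submod (submodule_lker gC)).
exists R, (sub_incl (submodule_lker gC) \o f)%VF; split=> //; first by modhom.
  apply/vspaceP=> x; apply/memv_imgP/idP=> [[r _ ->]|xg].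
    by rewrite comp_lfunE sub_inclE subvsP.
  have [r rE] := proj1 (limg_surj f) fT (vsproj _ x).
  by exists r; rewrite ?memvf // comp_lfunE sub_inclE -rE vsprojK.
have -> // : lker (sub_incl (submodule_lker gC) \o f)%VF = lker f.
apply/vspaceP=> x; rewrite !memv_ker comp_lfunE sub_inclE.
apply/eqP/eqP=> [f0|->]; last by rewrite linear0.
by apply: subvs_inj; rewrite f0 linear0.
Qed.

Definition presentation P1 P0 M (f : 'Hom(P1, P0)) (g : 'Hom(P0, M)) :=
  [/\ projective P1 /\ projective P0, f \in modhom P1 P0 /\ g \in modhom P0 M
    & limg g = fullv /\ limg f = lker g].

Lemma min_presentation_exists M : exists P1 P0 (f : 'Hom(P1, P0)) (g : 'Hom(P0, M)),
  min_presentation f g.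
Proof.
have [P0 [g [pP gC gT sg]]] := proj_cover M.
have [P1 [f [pR fC fT sf]]] := kernel_cover gC.
by exists P1, P0, f, g.
Qed.

(** Surjectivity of Hom(f, X). If f comes from a minimal presentation of M, it amounts to Hom(X, tau
    M) = 0, see [hom_kdual_eq0]. *)
Definition hom_onto P1 P0 (f : 'Hom(P1, P0)) X :=
  forall h : 'Hom(P1, X), h \in modhom P1 X ->
  exists2 t : 'Hom(P0, X), t \in modhom P0 X & forall x, t (f x) = h x.

(* Comparing the two presentations through lifts of the retraction, the
   composite R -> P1 -> R is, up to a map factoring through f', the identity
   plus an endomorphism with values in the superfluous kernel of f'. *)
Lemma hom_onto_transfer M P1 P0 (f : 'Hom(P1, P0)) (g : 'Hom(P0, M))
    N R Q (f' : 'Hom(R, Q)) (g' : 'Hom(Q, N)) X :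
  presentation f g -> presentation f' g' -> superfluous (lker f') ->
  retract N M -> hom_onto f X -> hom_onto f' X.
Proof.
move=> [[pP1 pP0] [fC gC] [gT fg]] [[pR pQ] [fC' gC'] [gT' fg']] sf [i [p [iC pC ip]]] H h hC.
have gf x : g (f x) = 0 by apply/eqP; rewrite -memv_ker -fg; apply/memv_img/memvf.
have gf' x : g' (f' x) = 0 by apply/eqP; rewrite -memv_ker -fg'; apply/memv_img/memvf.
have fgx y : g y = 0 -> exists x, y = f x.
  move=> /eqP; rewrite -memv_ker -fg => /memv_imgP[x _ ->]; by exists x.
have fgx' y : g' y = 0 -> exists x, y = f' x.
  move=> /eqP; rewrite -memv_ker -fg' => /memv_imgP[x _ ->]; by exists x.
have [v vC vE] : exists2 v : 'Hom(Q, P0), v \in modhom Q P0 &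
    forall x, g (v x) = (i \o g')%VF x.
  by apply: proj_lift => //; [modhom | move=> x; apply: (proj1 (limg_surj g))].
have [u uC uE] : exists2 u : 'Hom(P0, Q), u \in modhom P0 Q &
    forall x, g' (u x) = (p \o g)%VF x.
  by apply: proj_lift => //; [modhom | move=> x; apply: (proj1 (limg_surj g'))].
(* Since u v lifts p i = 1 on N, the difference u v - 1 takes its values in ker g' = im f'. *)
have [s sC sE] : exists2 s : 'Hom(Q, R), s \in modhom Q R &
    forall x, f' (s x) = ((u \o v) - \1)%VF x.
  apply: proj_lift => //; [by modhom | move=> x; apply: fgx'].
  rewrite add_lfunE opp_lfunE id_lfunE comp_lfunE linearB /= uE comp_lfunE vE.
  by rewrite comp_lfunE ip subrr.
have [v1 v1C v1E] : exists2 v1 : 'Hom(R, P1), v1 \in modhom R P1 &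
    forall x, f (v1 x) = (v \o f')%VF x.
  apply: proj_lift => //; [by modhom | move=> x; apply: fgx].
  by rewrite comp_lfunE vE comp_lfunE gf' linear0.
have [u1 u1C u1E] : exists2 u1 : 'Hom(P1, R), u1 \in modhom P1 R &
    forall x, f' (u1 x) = (u \o f)%VF x.
  apply: proj_lift => //; [by modhom | move=> x; apply: fgx'].
  by rewrite comp_lfunE uE comp_lfunE gf linear0.
have [t tC tE] := H (h \o u1)%VF ltac:(by modhom).
pose w := ((u1 \o v1) - (s \o f'))%VF : 'End(R).
have wC : w \in modhom R R by rewrite /w; modhom.
have wE x : w x = u1 (v1 x) - s (f' x) by rewrite add_lfunE opp_lfunE !comp_lfunE.
have fw x : f' (w x) = f' x.
  rewrite wE linearB /= u1E sE comp_lfunE v1E add_lfunE opp_lfunE id_lfunE !comp_lfunE.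
  by rewrite opprB addrC subrK.
have wT : limg w = fullv.
  apply: sf; first exact: submodule_limg.
  apply: fullv_mem => x; apply/memv_addP; exists (x - w x).
    by rewrite memv_ker linearB /= fw subrr.
  by exists (w x); rewrite ?subrK //; apply/memv_img/memvf.
(* On the image of w, which is everything: h w = h u1 v1 - h s f' = t f v1 - h s f' = (t v - h s)
   f', and f' = f' w. *)
exists ((t \o v) - (h \o s))%VF; first by modhom.
move=> y; have [x ->] := proj1 (limg_surj w) wT y.
rewrite fw add_lfunE opp_lfunE !comp_lfunE wE linearB /=; congr (_ - _).
by have := tE (v1 x); rewrite v1E !comp_lfunE.
Qed.
End Projectives.

(** * The criterion for tau-rigidity *)

Section Quotient.
Variables (k : fieldType) (C : falgType k) (M : fdmod C) (U : {vspace M}).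
Hypothesis US : submodule U.

(** The quotient M / U is carried by the complement [U^C], and [qpi] is the projection onto it along
    U. *)
Definition qpi (v : M) : subvs_of (U^C) := vsproj (U^C) (v - projv U v).
Fact qpi_linear : linear qpi.
Proof.
move=> c u v; rewrite /qpi -linearP; congr (vsproj _ _).
by rewrite linearP scalerBr opprD addrACA.
Qed.
HB.instance Definition _ :=
  GRing.isLinear.Build k M (subvs_of (U^C)) *:%R qpi qpi_linear.
Lemma qpiE v : vsval (qpi v) = v - projv U v.
Proof. by rewrite vsprojK // memv_projC. Qed.
Lemma qpiK t : qpi (vsval t) = t.
Proof.
apply: subvs_inj; rewrite qpiE.
have : vsval t \in lker (projv U) by rewrite lker_proj subvsP.
by rewrite memv_ker => /eqP->; rewrite subr0.
Qed.
Lemma qpi_eq0 v : (qpi v == 0) = (v \in U).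
Proof.
apply/eqP/idP=> [v0|vU]; last by rewrite /qpi projv_id // subrr linear0.
have /eqP := qpiE v; rewrite v0 linear0 eq_sym subr_eq0 => /eqP->.
exact: memv_proj.
Qed.
Lemma qpi_act a v : qpi (act a (vsval (qpi v))) = qpi (act a v).
Proof.
rewrite qpiE actB linearB /=; apply/eqP; rewrite subr_eq addrC -subr_eq subrr eq_sym.
by rewrite qpi_eq0; apply/US/memv_proj.
Qed.

Definition quot_act a (t : subvs_of (U^C)) := qpi (act a (vsval t)).
Fact quot_act_linear a : linear (quot_act a).
Proof. by move=> c u v; rewrite /quot_act !linearP. Qed.
Fact quot_act_linearl v : linear (quot_act^~ v).
Proof. by move=> c a b; rewrite /quot_act act_linearl linearP. Qed.
Fact quot_act1 v : quot_act 1 v = v.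
Proof. by rewrite /quot_act act1 qpiK. Qed.
Fact quot_actM a b v : quot_act (a * b) v = quot_act a (quot_act b v).
Proof. by rewrite /quot_act qpi_act actM. Qed.
Definition quot : fdmod C :=
  FdMod quot_act_linear quot_act_linearl quot_act1 quot_actM.
Definition qproj : 'Hom(M, quot) := linfun qpi.
Lemma qproj_modhom : qproj \in modhom M quot.
Proof. by apply/homP=> a v; rewrite !lfunE /= /quot_act qpi_act. Qed.
Lemma qproj_ker : lker qproj = U.
Proof. by apply/vspaceP=> x; rewrite memv_ker lfunE qpi_eq0. Qed.
Lemma qproj_img : limg qproj = fullv.
Proof. by apply/limg_surj=> y; exists (vsval y); rewrite lfunE /= qpiK. Qed.
End Quotient.

Lemma functional_sep (k : fieldType) (V : vectType k) (U : {vspace V}) v :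
  v \notin U -> exists2 l : 'Hom(V, k^o), (forall u, u \in U -> l u = 0) & l v != 0.
Proof.
move=> vU; pose w := v - projv U v.
have w0 : w != 0.
  by rewrite subr_eq0; apply: contraNneq vU => ->; rewrite memv_proj.
have [j wj] : exists j, coord (vbasis {:V}) j w != 0.
  apply: NNPP => H; case/eqP: w0; rewrite (coord_vbasis (memvf w)).
  apply: big1 => j _; have [->|] := eqVneq (coord (vbasis {:V}) j w) 0.
    by rewrite scale0r.
  by move=> nj; case: H; exists j.
have fl : linear (fun x => coord (vbasis {:V}) j (x - projv U x) : k^o).
  move=> c x y; rewrite (linearP (projv U)) opprD addrACA -scalerBr.
  by rewrite linearP.
exists (hom_of fl); last by rewrite hom_ofE.
by move=> u uU; rewrite hom_ofE projv_id // subrr linear0.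
Qed.

Section TauRigid.
Variables (k : fieldType) (C : falgType k).
Implicit Types (M N X Y Z P Q R : fdmod C).

Definition tens X P (x : X) (g : 'Hom(P, regular C)) : 'Hom(P, X).
Proof.
apply: (@hom_of k P X (fun p => act (g p : C) x)) => c u v.
by rewrite linearP /= act_linearl.
Defined.
Lemma tensE X P (x : X) (g : 'Hom(P, regular C)) p : tens x g p = act (g p : C) x.
Proof. exact: hom_ofE. Qed.
Lemma tens_modhom X P (x : X) (g : 'Hom(P, regular C)) :
  g \in modhom P (regular C) -> tens x g \in modhom P X.
Proof. by move=> gC; apply/homP=> a v; rewrite !tensE (modhomE gC) /= actM. Qed.

Lemma star_valP P (g : star P) : vsval g \in modhom P (regular C).
Proof. exact: subvsP. Qed.

Lemma star_dual_basis P n (e : 'I_n -> P) (g : 'I_n -> star P) (h : star P) :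
  (forall p, p = \sum_i act (vsval (g i) p : C) (e i)) ->
  h = \sum_i act (vsval h (e i) : C^c) (g i).
Proof.
move=> eg; apply/subvs_inj/lfunP=> p.
rewrite linear_sum sum_lfunE {1}(eg p) linear_sum; apply: eq_bigr => i _ /=.
by rewrite star_actE (modhomE (star_valP h)).
Qed.

(* Hom_C(X, DT) is the dual of T (x)_C X, which is the cokernel of
   Hom(P0, X) -> Hom(P1, X): the tensor g (x) x corresponds to the map
   p |-> g(p) x. *)
Lemma hom_kdual_eq0 P1 P0 (f : 'Hom(P1, P0)) X (T : fdmod C^c)
    (q : 'Hom(star P1, T)) :
  projective P1 -> projective P0 -> f \in modhom P1 P0 ->
  q \in modhom (star P1) T -> lker q = limg (star_map f) -> limg q = fullv ->
  modhom X (kdual T) = 0%VS <-> hom_onto f X.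
Proof.
move=> pP1 pP0 fC qC qk qT.
have [n [e [g0 [g0C eg]]]] := dual_basis pP1.
pose g i : star P1 := vsproj (modhom P1 (regular C)) (g0 i).
have gE i : vsval (g i) = g0 i by rewrite vsprojK.
have {}eg p : p = \sum_i act (vsval (g i) p : C) (e i).
  by rewrite [LHS]eg; apply: eq_bigr => i _; rewrite gE.
have qf (h : star P0) : q (star_map f h) = 0.
  by apply/eqP; rewrite -memv_ker qk; apply/memv_img/memvf.
split=> [X0 h hC|onto].
  pose r (t : 'Hom(P0, X)) : 'Hom(P1, X) := (t \o f)%VF.
  have rl : linear r by move=> c u v; rewrite /r comp_lfunDl comp_lfunZl.
  pose U := (hom_of rl @: modhom P0 X)%VS.
  have [/memv_imgP[t tC tE]|hU] := boolP (h \in U).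
    by exists t => // x; rewrite tE hom_ofE /r comp_lfunE.
  (* A functional l that kills all t f but not h defines a map X -> D T sending x to q s |-> l (tens
     x s). Its vanishing makes l vanish on every [tens x s], and h is a sum of such maps. *)
  have [l lU /eqP[]] := functional_sep hU.
  have lr t : t \in modhom P0 X -> l (t \o f)%VF = 0.
    by move=> tC; apply: lU; apply/memv_imgP; exists t; rewrite ?hom_ofE.
  have qV t : q (q^-1%VF t) = t by apply: limg_lfunVK; rewrite qT memvf.
  (* [q^-1%VF] is only a linear section of q; this independence of the representative makes the map
     C-linear. *)
  have wd (x : X) (s s' : star P1) : q s = q s' ->
      l (tens x (vsval s)) = l (tens x (vsval s')).
    move=> /eqP; rewrite -subr_eq0 -linearB -memv_ker qk => /memv_imgP[t _ tE].
    apply/eqP; rewrite -subr_eq0 -linearB /=; apply/eqP.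
    rewrite -(lr (tens x (vsval t))); last exact/tens_modhom/star_valP.
    congr (l _); apply/lfunP=> p; rewrite add_lfunE opp_lfunE comp_lfunE !tensE.
    by rewrite -star_mapE // -tE linearB /= add_lfunE opp_lfunE actBl.
  have bl1 x : linear (fun t => l (tens x (vsval (q^-1%VF t))) : k^o).
    move=> c s t; rewrite -[RHS]linearP; congr (l _); apply/lfunP=> p.
    rewrite add_lfunE scale_lfunE !tensE (linearP q^-1%VF) /=.
    transitivity (act ((c *: vsval (q^-1%VF s) + vsval (q^-1%VF t)) p : C) x) => //.
    by rewrite add_lfunE scale_lfunE act_linearl.
  have bl2 : linear (fun x : X => hom_of (bl1 x) : kdual T).
    move=> c x y; apply/lfunP=> t; rewrite add_lfunE scale_lfunE !hom_ofE -linearP.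
    congr (l _); apply/lfunP=> p.
    by rewrite add_lfunE scale_lfunE !tensE linearP.
  have : hom_of bl2 \in modhom X (kdual T).
    apply: modhom_of => a x; apply/lfunP=> t; rewrite kdual_actE !hom_ofE.
    rewrite (wd x (q^-1%VF (act (a : C^c) t)) (act (a : C^c) (q^-1%VF t))); last first.
      by rewrite (modhomE qC) !qV.
    congr (l _); apply/lfunP=> p; rewrite !tensE /= star_actE.
    by rewrite (@actM k C X).
  rewrite X0 memv0 => /eqP b0.
  have l0 x (s : star P1) : l (tens x (vsval s)) = 0.
    have /lfunP/(_ x) := b0; rewrite hom_ofE zero_lfunE => /lfunP/(_ (q s)).
    rewrite hom_ofE => E.
    transitivity (l (tens x (vsval (q^-1%VF (q s))))); first by apply: wd; rewrite qV.
    by apply: etrans E _; apply: zero_lfunE.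
  have -> : h = \sum_i tens (h (e i)) (vsval (g i)).
    apply/lfunP=> p; rewrite {1}(eg p) linear_sum sum_lfunE; apply: eq_bigr => i _.
    by rewrite tensE /= (modhomE hC).
  by rewrite linear_sum big1 // => i _; apply: l0.
apply/eqP; rewrite -subv0; apply/subvP=> b bC; rewrite memv0; apply/eqP.
apply/lfunP=> x; apply/lfunP=> t; rewrite !zero_lfunE.
have [s ->] := proj1 (limg_surj q) qT t.
(* Expanding b x (q s) by [key], replacing [tens x s] by r f and expanding f (e i) in the dual basis
   of P0 gives a double sum; summed over i first, it is made of values of q on [star_map f], which
   are zero. *)
have key y (h : star P1) : \sum_i b (act (vsval h (e i) : C) y) (q (g i)) = b y (q h).
  rewrite {2}(star_dual_basis h eg) !linear_sum; apply: eq_bigr => i _.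
  by rewrite (modhomE bC) /= kdual_actE (modhomE qC).
have [m [e' [g0' [g0C' eg']]]] := dual_basis pP0.
have [r rC rE] := onto (tens x (vsval s)) (tens_modhom x (star_valP s)).
pose g' j : star P0 := vsproj (modhom P0 (regular C)) (g0' j).
have gE' j : vsval (g' j) = g0' j by rewrite vsprojK.
rewrite -key.
transitivity (\sum_j b (r (e' j)) (q (star_map f (g' j)))); last first.
  by apply: big1 => j _; rewrite qf linear0.
under [RHS]eq_bigr => j _ do rewrite -key.
rewrite exchange_big; apply: eq_bigr => i _ /=.
rewrite -[act _ x]tensE -rE (eg' (f (e i))) !linear_sum sum_lfunE; apply: eq_bigr => j _ /=.
by rewrite star_mapE // gE' (modhomE rC).
Qed.

(** Any presentation may witness tau-rigidity: the property is transferred to a minimal one, whose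
    transpose is built as a quotient. *)
Lemma tau_rigidE M : tau_rigid M <->
  exists P1 P0 (f : 'Hom(P1, P0)) (g : 'Hom(P0, M)), presentation f g /\ hom_onto f M.
Proof.
split=> [[N [T [P1 [P0 [f [g [q [[pP fg gT sf] qC qk qT]]]]]] isoN] MN0]|].
  exists P1, P0, f, g; split=> //; case: pP fg => pP1 pP0 [fC gC].
  apply/(hom_kdual_eq0 M pP1 pP0 fC qC qk qT).
  have /isoE[i [p [iC pC ip pi]]] := isoN.
  apply/eqP; rewrite -subv0; apply/subvP=> h hC; rewrite memv0.
  have : (p \o h)%VF \in modhom M N by apply: modhom_comp.
  rewrite MN0 memv0 => /eqP ph; apply/eqP/lfunP=> x.
  have phx : p (h x) = 0 by rewrite -[LHS]comp_lfunE ph zero_lfunE.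
  by rewrite -(pi (h x)) phx zero_lfunE linear0.
case=> [P1 [P0 [f [g [pr onto]]]]].
have [R [Q [f' [g' mp]]]] := min_presentation_exists M.
have [pP fg gT [sg sf]] := mp.
have onto' : hom_onto f' M.
  by apply: (hom_onto_transfer pr (g' := g') _ sf (retract_refl M) onto).
have [pR pQ] := pP; have [fC gC] := fg.
have sC : star_map f' \in modhom (star Q) (star R).
  apply/homP=> a s; apply/subvs_inj/lfunP=> x.
  by rewrite star_mapE // !star_actE star_mapE.
pose S := submodule_limg sC.
exists (kdual (quot S)); last first.
  by apply/(hom_kdual_eq0 M pR pQ fC (qproj_modhom S) (qproj_ker S) (qproj_img S)).
exists (quot S); last exact: iso_refl.
exists R, Q, f', g', (qproj S); split=> //.
- exact: qproj_modhom.
- exact: qproj_ker.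
- exact: qproj_img.
Qed.

(** Here [f] has to cover ker g, while [g] may be any surjection from a projective. *)
Lemma tau_rigid_cover M P1 P0 (f : 'Hom(P1, P0)) (g : 'Hom(P0, M)) :
  tau_rigid M -> presentation f g -> superfluous (lker f) -> hom_onto f M.
Proof.
move=> /tau_rigidE[R [Q [f' [g' [pr onto]]]]] pr' sf.
exact: hom_onto_transfer pr pr' sf (retract_refl M) onto.
Qed.

Lemma tau_rigid_retract M N : tau_rigid M -> retract N M -> tau_rigid N.
Proof.
move=> /tau_rigidE[R [Q [f [g [pr onto]]]]] NM; apply/tau_rigidE.
have [P1 [P0 [f' [g' [pP fg gT [sg sf]]]]]] := min_presentation_exists N.
exists P1, P0, f', g'; split=> //.
apply: (hom_onto_transfer pr (g' := g') _ sf NM) => // h hC.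
have [i [p [iC pC ip]]] := NM.
have [t tC tE] := onto (i \o h)%VF (modhom_comp iC hC).
exists (p \o t)%VF; first exact: modhom_comp.
by move=> x; rewrite comp_lfunE tE comp_lfunE ip.
Qed.
End TauRigid.

(** * Fully faithful functors *)

Lemma iso_zero (k : fieldType) (C : falgType k) (M N : fdmod C) :
  iso M N -> zero M -> zero N.
Proof. by rewrite /zero => /iso_dim->. Qed.

Lemma iso_indec (k : fieldType) (C : falgType k) (M N : fdmod C) :
  iso M N -> indecomposable M -> indecomposable N.
Proof.
move=> MN [nM HM]; split; first by move/(iso_zero (iso_sym MN)).
by move=> X Y NXY; apply: HM; apply: iso_trans NXY.
Qed.

(** Indecomposability in terms of idempotents, the form that fully faithful functors preserve and
    reflect. *)
Lemma indecomposableE (k : fieldType) (C : falgType k) (X : fdmod C) :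
  indecomposable X <-> ~ zero X /\ forall e : 'End(X), e \in modhom X X ->
    (e \o e)%VF = e -> e = 0 \/ e = \1%VF.
Proof.
split=> [iX|[nX H]]; split=> //; first exact: indec_nzero iX.
  move=> e eC ee; have eE x : e (e x) = e x by rewrite -{3}ee comp_lfunE.
  have [ei|[n en]] := indec_endo iX eC; [right|left]; apply/lfunP=> x.
    by rewrite id_lfunE; apply: ei; rewrite eE.
  suff <- : iter n.+1 e x = e x by rewrite iterS en linear0 zero_lfunE.
  by elim: (n) => //= m ->; rewrite eE.
move=> Y1 Y2 /isoE[f [g [fC gC fK gK]]].
pose e := (g \o (dinl Y1 Y2 \o (dfst Y1 Y2 \o f)))%VF : 'End(X).
have eE x : e (g x) = g (x.1, 0) by rewrite !comp_lfunE gK dinlE dfstE.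
have gf x : g (f x) = x := fK x.
have [] := H e.
- by rewrite /e; modhom.
- by apply/lfunP=> x; rewrite comp_lfunE -(gf x) !eE.
- move=> e0; left; apply/zeroP=> y.
  have := eE (y, 0); rewrite e0 zero_lfunE /= => /(congr1 f).
  by rewrite linear0 gK; case.
- move=> e1; right; apply/zeroP=> y.
  have := eE (0, y); rewrite e1 id_lfunE /= => /(can_inj gK); by case.
Qed.

(** Homomorphisms form a subspace of the linear maps, so [fmap] is total on linear maps and its laws
    concern members of [modhom]. *)
Record ff_functor (k : fieldType) (B A : falgType k) := FFFunctor {
  fobj :> fdmod B -> fdmod A;
  fmap : forall M N : fdmod B, 'Hom(M, N) -> 'Hom(fobj M, fobj N);
  fmap_modhom : forall (M N : fdmod B) (f : 'Hom(M, N)),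
    f \in modhom M N -> fmap f \in modhom (fobj M) (fobj N);
  fmap_id : forall M : fdmod B, fmap (\1%VF : 'End(M)) = \1%VF;
  fmap_comp : forall (M N Q : fdmod B) (g : 'Hom(N, Q)) (f : 'Hom(M, N)),
    g \in modhom N Q -> f \in modhom M N -> fmap (g \o f)%VF = (fmap g \o fmap f)%VF;
  fmapD : forall (M N : fdmod B) (f g : 'Hom(M, N)),
    f \in modhom M N -> g \in modhom M N -> fmap (f + g) = fmap f + fmap g;
  fmap_full : forall (M N : fdmod B) (g : 'Hom(fobj M, fobj N)),
    g \in modhom (fobj M) (fobj N) -> exists2 f : 'Hom(M, N), f \in modhom M N & fmap f = g;
  fmap_faithful : forall (M N : fdmod B) (f g : 'Hom(M, N)),
    f \in modhom M N -> g \in modhom M N -> fmap f = fmap g -> f = g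
}.

Section FullyFaithful.
Variables (k : fieldType) (B A : falgType k) (F : ff_functor B A).
Implicit Types (M N X Y Z : fdmod B).

Lemma fmap_cancel M N (f : 'Hom(M, N)) (g : 'Hom(N, M)) :
  f \in modhom M N -> g \in modhom N M -> cancel f g <-> cancel (fmap F f) (fmap F g).
Proof.
move=> fC gC; split=> fg.
  move=> x; rewrite -comp_lfunE -fmap_comp //.
  have -> : (g \o f)%VF = \1%VF by apply/lfunP=> y; rewrite comp_lfunE fg id_lfunE.
  by rewrite fmap_id id_lfunE.
have E : (g \o f)%VF = \1%VF.
  apply: (@fmap_faithful _ _ _ F); [by modhom | by modhom |].
  by rewrite fmap_comp // fmap_id; apply/lfunP=> x; rewrite comp_lfunE fg id_lfunE.
by move=> x; rewrite -comp_lfunE E id_lfunE.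
Qed.

Lemma ff_retract X M : retract X M <-> retract (F X) (F M).
Proof.
split=> [[i [p [iC pC /(fmap_cancel iC pC) ip]]]|[i' [p' [i'C p'C]]]].
  by exists (fmap F i), (fmap F p); split=> //; apply: fmap_modhom.
have [i iC <-] := fmap_full i'C; have [p pC <-] := fmap_full p'C.
by move/(fmap_cancel iC pC) => ip; exists i, p.
Qed.

Lemma ff_iso M N : iso M N <-> iso (F M) (F N).
Proof.
split=> /isoE.
  case=> f [g [fC gC fK gK]]; apply/isoE; exists (fmap F f), (fmap F g).
  by split; [exact: fmap_modhom | exact: fmap_modhom | exact/fmap_cancel | exact/fmap_cancel].
case=> f' [g' [f'C g'C]].
have [f fC <-] := fmap_full f'C; have [g gC <-] := fmap_full g'C.
move=> /(fmap_cancel fC gC) fK /(fmap_cancel gC fC) gK.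
by apply/isoE; exists f, g.
Qed.

(** The idempotent i p of F M comes from an idempotent of M, which splits over its image. *)
Lemma ff_split (Y : fdmod A) M : retract Y (F M) -> exists2 X, retract X M & iso Y (F X).
Proof.
case=> i [p [iC pC ip]].
have [e eC eE] := fmap_full (modhom_comp iC pC).
have ee : (e \o e)%VF = e.
  apply: (@fmap_faithful _ _ _ F) => //; first by modhom.
  by rewrite fmap_comp // eE; apply/lfunP=> x; rewrite !comp_lfunE ip.
pose S := submodule_limg eC.
have [q qC qE] := sub_corestrict S eC (subvv _).
have jC := sub_incl_modhom S.
have qj : cancel (sub_incl S) q.
  move=> x; apply: subvs_inj; rewrite qE sub_inclE.
  by have /memv_imgP[y _ ->] := subvsP x; rewrite -comp_lfunE ee.
have jq : (sub_incl S \o q)%VF = e.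
  by apply/lfunP=> x; rewrite comp_lfunE sub_inclE qE.
exists (submod S); first by exists (sub_incl S), q.
have FqC := fmap_modhom F qC; have FjC := fmap_modhom F jC.
apply/isoE; exists (fmap F q \o i)%VF, (p \o fmap F (sub_incl S))%VF.
have E x : fmap F (sub_incl S) (fmap F q x) = i (p x).
  by rewrite -comp_lfunE -fmap_comp // jq eE comp_lfunE.
split; [by modhom | by modhom | |] => x; rewrite !comp_lfunE.
  by rewrite E !ip.
by rewrite -E !(proj1 (fmap_cancel jC qC) qj).
Qed.

Lemma fmap0 M N : fmap F (0 : 'Hom(M, N)) = 0.
Proof.
by apply: (addrI (fmap F 0)); rewrite -fmapD ?mem0v // !addr0.
Qed.

Lemma ff_zero M : zero (F M) <-> zero M.
Proof.
have E (C : falgType k) (X : fdmod C) : zero X <-> (\1%VF : 'End(X)) = 0.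
  split=> [/zeroP z|e]; first by apply/lfunP=> x; rewrite (z x) !linear0.
  by apply/zeroP=> x; rewrite -(id_lfunE x) e zero_lfunE.
split=> /E e; apply/E; last by rewrite -fmap_id e fmap0.
by apply: (@fmap_faithful _ _ _ F); rewrite ?fmap_id ?fmap0 ?modhom_id ?mem0v.
Qed.

Lemma ff_indec M : indecomposable M <-> indecomposable (F M).
Proof.
split=> /indecomposableE[nz H]; apply/indecomposableE; split; try by move/ff_zero.
  move=> e' /fmap_full[e eC <-]; rewrite -fmap_comp // => /fmap_faithful ee.
  have [|->|->] := H e eC; last 2 first.
  - by left; apply: fmap0.
  - by right; apply: fmap_id.
  - by apply: ee => //; modhom.
move=> e eC ee; have [||e0|e1] := H (fmap F e).
- exact: fmap_modhom.
- by rewrite -fmap_comp // ee.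
- by left; apply: (@fmap_faithful _ _ _ F); rewrite ?mem0v ?fmap0.
- by right; apply: (@fmap_faithful _ _ _ F); rewrite ?modhom_id ?fmap_id.
Qed.

Lemma ff_dsum M N : iso (F (dsum M N)) (dsum (F M) (F N)).
Proof.
pose f := ((dinl (F M) (F N) \o fmap F (dfst M N)) +
           (dinr (F M) (F N) \o fmap F (dsnd M N)))%VF.
pose g := ((fmap F (dinl M N) \o dfst (F M) (F N)) +
           (fmap F (dinr M N) \o dsnd (F M) (F N)))%VF.
have h1 := fmap_modhom F (dfst_modhom M N).
have h2 := fmap_modhom F (dsnd_modhom M N).
have h3 := fmap_modhom F (dinl_modhom M N).
have h4 := fmap_modhom F (dinr_modhom M N).
have fE x : f x = (fmap F (dfst M N) x, fmap F (dsnd M N) x).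
  by rewrite add_lfunE !comp_lfunE dinlE dinrE; congr pair; rewrite /= ?addr0 ?add0r.
have gE x : g x = fmap F (dinl M N) x.1 + fmap F (dinr M N) x.2.
  by rewrite add_lfunE !comp_lfunE dfstE dsndE.
apply/isoE; exists f, g; split; [by rewrite /f; modhom | by rewrite /g; modhom | |] => x.
  rewrite gE fE /= -![fmap _ _ (fmap _ _ _)]comp_lfunE.
  rewrite -!fmap_comp ?dinl_modhom ?dinr_modhom ?dfst_modhom ?dsnd_modhom //.
  rewrite -add_lfunE -fmapD; try by modhom.
  rewrite -[RHS]id_lfunE -fmap_id; congr (fmap F _ x).
  by apply/lfunP=> v; rewrite add_lfunE !comp_lfunE -dsum_split id_lfunE.
case: x => x y; rewrite fE gE /=.
have K X Y Z (a : 'Hom(X, Y)) (b : 'Hom(Y, Z)) z : a \in modhom X Y -> b \in modhom Y Z ->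
   fmap F b (fmap F a z) = fmap F (b \o a)%VF z.
  by move=> aC bC; rewrite fmap_comp // comp_lfunE.
rewrite !linearD /= !K; try by modhom.
have -> : (dfst M N \o dinl M N)%VF = \1%VF.
  by apply/lfunP=> v; rewrite comp_lfunE dinlE dfstE id_lfunE.
have -> : (dsnd M N \o dinr M N)%VF = \1%VF.
  by apply/lfunP=> v; rewrite comp_lfunE dinrE dsndE id_lfunE.
have -> : (dfst M N \o dinr M N)%VF = 0.
  by apply/lfunP=> v; rewrite comp_lfunE dinrE dfstE zero_lfunE.
have -> : (dsnd M N \o dinl M N)%VF = 0.
  by apply/lfunP=> v; rewrite comp_lfunE dinlE dsndE zero_lfunE.
by rewrite !fmap_id !fmap0 !zero_lfunE !id_lfunE addr0 add0r.
Qed.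

Lemma ff_basic M : basic M -> basic (F M).
Proof.
move=> /basicE bM; apply/basicE=> X Y iX iY XY isoXY.
have [X1 _ XX1] := ff_split (retract_trans (retract_inl _ _) XY).
have [Y1 _ YY1] := ff_split (retract_trans (retract_inr _ _) XY).
have indF (U : fdmod A) V : indecomposable U -> iso U (F V) -> indecomposable V.
  by move=> iU UV; apply/ff_indec/(iso_indec UV).
apply: (bM X1 Y1 (indF _ _ iX XX1) (indF _ _ iY YY1)).
  apply/ff_retract; apply: retract_trans (iso_retract (ff_dsum _ _)) _.
  by apply: retract_trans XY; apply: retract_dsum; apply/iso_retract/iso_sym.
apply/ff_iso; apply: iso_trans (iso_sym XX1) _.
exact: iso_trans isoXY YY1.
Qed.

Lemma ff_num M n : num_summands M n -> num_summands (F M) n.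
Proof.
move=> /num_summandsE[X [Xi Xinj Xs]]; apply/num_summandsE.
exists (fun i => F (X i)); split.
- by move=> i; have [iX XM] := Xi i; split; [apply/ff_indec | apply/ff_retract].
- by move=> i j /ff_iso/Xinj.
- move=> Y iY YM; have [Y1 Y1M YY1] := ff_split YM.
  have [i Yi] : exists i, iso Y1 (X i).
    by apply: Xs => //; apply/ff_indec/(iso_indec YY1).
  by exists i; apply: iso_trans YY1 _; apply/ff_iso.
Qed.
End FullyFaithful.

(** * Modules over the one-point extension *)

Section OnePointModules.
Variables (k : fieldType) (B : falgType k) (P0 : fdmod B).
Local Notation A := (onept P0).
Local Notation inj := (onept_inj P0).
Local Notation e := (onept_e P0).
Implicit Types (M N Q : fdmod B) (X Y : fdmod A).

Definition onept_col (p : P0) (x : k) : A := (0, p, x).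

Lemma onept_mulE (u v : A) :
  u * v = (u.1.1 * v.1.1, act u.1.1 v.1.2 + (v.2 : k) *: u.1.2, (u.2 : k) * v.2) :> A.
Proof. by []. Qed.

Lemma onept_split (a : A) : a = inj a.1.1 + onept_col a.1.2 a.2.
Proof.
case: a => [[b p] x]; congr (_, _, _); rewrite /= ?addr0 ?add0r //.
Qed.

Lemma mul_inj (b c : B) : inj b * inj c = inj (b * c).
Proof. by rewrite onept_mulE /= act0 scaler0 addr0 mulr0. Qed.

Lemma mulr_inj (a : A) (c : B) : a * inj c = inj (a.1.1 * c).
Proof. by rewrite onept_mulE /= act0 scale0r addr0 mulr0. Qed.

Lemma mulr_col (a : A) p x :
  a * onept_col p x = onept_col (act a.1.1 p + x *: a.1.2) ((a.2 : k) * x).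
Proof. by rewrite onept_mulE /= mulr0. Qed.

Lemma onept_split1 : 1 = e + onept_col 0 1 :> A.
Proof. by rewrite {1}(onept_split 1). Qed.

Lemma extU_val (u : extU P0) : e * vsval u = vsval u.
Proof. exact/extU_spaceP/subvsP. Qed.

Lemma extU_val2 (u : extU P0) : (vsval u).2 = 0.
Proof. by rewrite -extU_val onept_mulE /= mul0r. Qed.

(* A B-linear map e_B X -> M, extended by zero to the complement of e_B X. *)
Definition semihom X M (f : 'Hom(X, M)) :=
  forall b x, f (act (inj b) x) = act b (f x).

Lemma semihom_e X M (f : 'Hom(X, M)) x : semihom f -> f (act e x) = f x.
Proof. by move=> fS; rewrite fS act1. Qed.

Lemma semihom_comp X M N (g : 'Hom(M, N)) (f : 'Hom(X, M)) :
  g \in modhom M N -> semihom f -> semihom (g \o f)%VF.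
Proof. by move=> gC fS b x; rewrite !comp_lfunE fS (modhomE gC). Qed.

Definition eU : extU P0 := vsproj (extU_space P0) e.
Lemma eUE : vsval eU = e.
Proof.
rewrite vsprojK //; apply/extU_spaceP.
by rewrite mulr_inj mulr1.
Qed.

(** Evaluation at e_B is the counit of the adjunction between X |-> e_B X and E; it identifies e_B E
    M with M. *)
Definition counit M : 'Hom(ext P0 M, M).
Proof.
apply: (@hom_of k (ext P0 M) M (fun w => vsval w eU)) => c u v.
by rewrite -scale_lfunE -add_lfunE.
Defined.
Lemma counitE M w : counit M w = vsval w eU.
Proof. exact: hom_ofE. Qed.

Lemma counit_semihom M : semihom (counit M).
Proof.
move=> b w; rewrite !counitE ext_actE -(modhomE (subvsP w)); congr (vsval w _).
apply: subvs_inj; rewrite extU_rE extU_actE eUE !mulr_inj.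
by rewrite /= mul1r mulr1.
Qed.

Lemma ext_valE M (w : ext P0 M) u : vsval w u = counit M (act (vsval u) w).
Proof.
rewrite counitE ext_actE; congr (vsval w _); apply: subvs_inj.
by rewrite extU_rE eUE extU_val.
Qed.

Lemma ext_inj M (w w' : ext P0 M) :
  (forall u : extU P0, counit M (act (vsval u) w) = counit M (act (vsval u) w')) -> w = w'.
Proof. by move=> H; apply/subvs_inj/lfunP=> u; rewrite !ext_valE. Qed.

Lemma extU_mul_e (u : extU P0) : vsval u * e = inj (vsval u).1.1.
Proof. by rewrite mulr_inj mulr1. Qed.

Lemma ext_inj_e M (w w' : ext P0 M) :
  act e w = w -> act e w' = w' -> counit M w = counit M w' -> w = w'.
Proof.
move=> ew ew' ww'; apply: ext_inj => u.
by rewrite -ew -ew' -!actM extU_mul_e !counit_semihom ww'.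
Qed.

(** The uniqueness half of the adjunction; [adj] gives existence. *)
Lemma ext_hom_inj M X (f g : 'Hom(X, ext P0 M)) :
  f \in modhom X (ext P0 M) -> g \in modhom X (ext P0 M) ->
  (forall x, counit M (f x) = counit M (g x)) -> f = g.
Proof.
move=> fC gC fg; apply/lfunP=> x; apply: ext_inj => u.
by rewrite -(modhomE fC) -(modhomE gC).
Qed.

Definition adj_fun M X (f : 'Hom(X, M)) (x : X) : 'Hom(extU P0, M).
Proof.
apply: (@hom_of k (extU P0) M (fun u => f (act (vsval u) x))) => c u v.
by rewrite -linearP; congr (f _); rewrite -act_linearl.
Defined.
Lemma adj_funE M X (f : 'Hom(X, M)) x u : adj_fun f x u = f (act (vsval u) x).
Proof. exact: hom_ofE. Qed.
(** Meant for a [semihom] f: then u |-> f (u x) is B-linear and [vsproj] leaves it unchanged. *)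
Definition adj M X (f : 'Hom(X, M)) : 'Hom(X, ext P0 M).
Proof.
apply: (@hom_of k X (ext P0 M)
  (fun x => vsproj (modhom (extU P0) M) (adj_fun f x))) => c u v.
rewrite -linearP; congr (vsproj _ _); apply/lfunP=> y.
by rewrite add_lfunE scale_lfunE !adj_funE linearP /= linearP.
Defined.
Lemma adjE M X (f : 'Hom(X, M)) x u : semihom f ->
  vsval (adj f x) u = f (act (vsval u) x).
Proof.
move=> fS; rewrite hom_ofE vsprojK ?adj_funE //.
by apply/homP=> b v; rewrite !adj_funE extU_actE actM fS.
Qed.
Lemma adj_modhom M X (f : 'Hom(X, M)) : semihom f -> adj f \in modhom X (ext P0 M).
Proof.
move=> fS; apply/homP=> a x; apply/subvs_inj/lfunP=> u.
by rewrite ext_actE !adjE // extU_rE actM.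
Qed.
Lemma counit_adj M X (f : 'Hom(X, M)) x : semihom f -> counit M (adj f x) = f x.
Proof. by move=> fS; rewrite counitE adjE // eUE semihom_e. Qed.

Lemma infl_e M (m : infl P0 M) : act e m = m.
Proof. exact: act1. Qed.

Lemma infl_semihom M N (f : 'Hom(infl P0 M, N)) : f \in modhom M N -> semihom f.
Proof. by move=> /homP fC b x; apply: fC. Qed.

(** The natural embedding of M in E M, with image e_B E M. *)
Definition ext_unit M : 'Hom(infl P0 M, ext P0 M) :=
  adj (\1%VF : 'Hom(infl P0 M, M)).
Lemma ext_unit_modhom M : ext_unit M \in modhom (infl P0 M) (ext P0 M).
Proof. exact/adj_modhom/infl_semihom/modhom_id. Qed.
Lemma counit_unit M m : counit M (ext_unit M m) = m.
Proof. by rewrite counit_adj ?id_lfunE //; apply/infl_semihom/modhom_id. Qed.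
Lemma ext_unit_e M m : act e (ext_unit M m) = ext_unit M m.
Proof. by rewrite -(modhomE (ext_unit_modhom M)) infl_e. Qed.
Lemma ee_idem X (x : X) : act e (act e x) = act e x.
Proof. by rewrite -actM mulr_inj mulr1. Qed.
Lemma ext_e M (w : ext P0 M) : act e w = ext_unit M (counit M w).
Proof.
apply: ext_inj_e; rewrite ?ee_idem ?ext_unit_e //.
by rewrite counit_unit counit_semihom act1.
Qed.

Definition ext_map M N (f : 'Hom(M, N)) : 'Hom(ext P0 M, ext P0 N) :=
  adj (f \o counit M)%VF.
Lemma ext_map_modhom M N (f : 'Hom(M, N)) : f \in modhom M N ->
  ext_map f \in modhom (ext P0 M) (ext P0 N).
Proof. by move=> fC; apply/adj_modhom/semihom_comp => //; apply: counit_semihom. Qed.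
Lemma counit_map M N (f : 'Hom(M, N)) w : f \in modhom M N ->
  counit N (ext_map f w) = f (counit M w).
Proof.
move=> fC; rewrite counit_adj ?comp_lfunE //.
by apply: semihom_comp => //; apply: counit_semihom.
Qed.

Lemma ext_mapE M N (f : 'Hom(M, N)) (w : ext P0 M) u : f \in modhom M N ->
  vsval (ext_map f w) u = f (vsval w u).
Proof.
move=> fC; rewrite ext_valE -(modhomE (ext_map_modhom fC)) counit_map //.
by rewrite -ext_valE.
Qed.

Lemma ext_map_id M : ext_map (\1%VF : 'End(M)) = \1%VF.
Proof.
apply: ext_hom_inj; rewrite ?modhom_id ?ext_map_modhom ?modhom_id // => x.
by rewrite counit_map ?modhom_id // !id_lfunE.
Qed.
Lemma ext_map_comp M N Q (g : 'Hom(N, Q)) (f : 'Hom(M, N)) :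
  g \in modhom N Q -> f \in modhom M N -> ext_map (g \o f)%VF = (ext_map g \o ext_map f)%VF.
Proof.
move=> gC fC; apply: ext_hom_inj => [||x].
- by apply/ext_map_modhom/modhom_comp.
- by apply: modhom_comp; apply: ext_map_modhom.
- by rewrite comp_lfunE !counit_map ?modhom_comp // comp_lfunE.
Qed.
Lemma ext_mapD M N (f g : 'Hom(M, N)) :
  f \in modhom M N -> g \in modhom M N -> ext_map (f + g) = ext_map f + ext_map g.
Proof.
move=> fC gC; apply: ext_hom_inj => [||x].
- by apply/ext_map_modhom/modhomD.
- by apply: modhomD; apply: ext_map_modhom.
- by rewrite add_lfunE linearD /= !counit_map ?modhomD // add_lfunE.
Qed.
Lemma ext_map_full M N (g : 'Hom(ext P0 M, ext P0 N)) :
  g \in modhom (ext P0 M) (ext P0 N) -> exists2 f : 'Hom(M, N), f \in modhom M N & ext_map f = g.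
Proof.
(* The preimage of g is its restriction to e_B E M, read as a map M -> N. *)
move=> gC; pose f : 'Hom(M, N) := (counit N \o (g \o ext_unit M))%VF.
have fC : f \in modhom M N.
  apply/homP=> b m; rewrite !comp_lfunE -counit_semihom -(modhomE gC).
  congr (counit N (g _)).
  by rewrite -[RHS](modhomE (ext_unit_modhom M)).
exists f => //; apply: ext_hom_inj => // [|w]; first exact: ext_map_modhom.
rewrite counit_map // !comp_lfunE -ext_e (modhomE gC) semihom_e //.
exact: counit_semihom.
Qed.
Lemma ext_map_faithful M N (f g : 'Hom(M, N)) :
  f \in modhom M N -> g \in modhom M N -> ext_map f = ext_map g -> f = g.
Proof.
move=> fC gC fg; apply/lfunP=> m.
by rewrite -(counit_unit m) -!counit_map // fg.
Qed.
Definition ext_functor : ff_functor B A :=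
  FFFunctor ext_map_modhom ext_map_id ext_map_comp ext_mapD ext_map_full ext_map_faithful.

Lemma infl_modhom M N (f : 'Hom(M, N)) :
  (f \in modhom (infl P0 M) (infl P0 N)) = (f \in modhom M N).
Proof.
apply/homP/homP=> fC a v; first exact: (fC (inj a)).
exact: fC.
Qed.

Definition infl_map M N (f : 'Hom(M, N)) : 'Hom(infl P0 M, infl P0 N) := f.
Fact infl_map_modhom M N (f : 'Hom(M, N)) : f \in modhom M N ->
  infl_map f \in modhom (infl P0 M) (infl P0 N).
Proof. by rewrite infl_modhom. Qed.
Fact infl_map_full M N (g : 'Hom(infl P0 M, infl P0 N)) :
  g \in modhom (infl P0 M) (infl P0 N) -> exists2 f : 'Hom(M, N), f \in modhom M N & infl_map f = g.
Proof. by rewrite infl_modhom => gC; exists g. Qed.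
Definition infl_functor : ff_functor B A :=
  @FFFunctor k B A (infl P0) infl_map infl_map_modhom (fun=> erefl)
    (fun _ _ _ _ _ _ _ => erefl) (fun _ _ _ _ _ _ => erefl) infl_map_full
    (fun _ _ _ _ _ _ => id).
End OnePointModules.

(** * The new indecomposable projective A e_0 *)

Section NewProjective.
Variables (k : fieldType) (B : falgType k) (P0 : fdmod B).
Local Notation A := (onept P0).
Local Notation inj := (onept_inj P0).
Local Notation e := (onept_e P0).
Local Notation col := (@onept_col k B P0).
Implicit Types (M N Q : fdmod B) (X Y : fdmod A).

(* The projective A e_0, e_0 = 1 - e_B: the second column of the matrices. *)
Definition col_act (a : A) (v : P0 * k^o) : P0 * k^o :=
  (act a.1.1 v.1 + (v.2 : k) *: a.1.2, (a.2 : k) * v.2).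
Lemma col_actE a v : col (col_act a v).1 (col_act a v).2 = a * col v.1 v.2.
Proof. by rewrite mulr_col. Qed.
Lemma onept_col_inj (v w : P0 * k^o) : col v.1 v.2 = col w.1 w.2 -> v = w.
Proof. by case: v w => [p x] [q y] [-> ->]. Qed.
Lemma onept_col_linear c (v w : P0 * k^o) :
  col (c *: v + w).1 (c *: v + w).2 =
  c *: col v.1 v.2 + col w.1 w.2 :> A.
Proof. by congr (_, _, _); rewrite /= scaler0 addr0. Qed.
Fact col_act_linear a : linear (col_act a).
Proof.
move=> c v w; apply: onept_col_inj; rewrite onept_col_linear !col_actE.
by rewrite onept_col_linear mulrDr scalerAr.
Qed.
Fact col_act_linearl v : linear (col_act^~ v).
Proof.
move=> c a b; apply: onept_col_inj; rewrite onept_col_linear !col_actE.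
by rewrite mulrDl scalerAl.
Qed.
Fact col_act1 v : col_act 1 v = v.
Proof. by apply: onept_col_inj; rewrite col_actE mul1r. Qed.
Fact col_actM a b v : col_act (a * b) v = col_act a (col_act b v).
Proof. by apply: onept_col_inj; rewrite !col_actE mulrA. Qed.
Definition colmod : fdmod A :=
  FdMod col_act_linear col_act_linearl col_act1 col_actM.

Definition col_hom X (v : X) : 'Hom(colmod, X).
Proof.
apply: (@hom_of k colmod X (fun w => act (col w.1 w.2) v)) => c u w.
by rewrite onept_col_linear act_linearl.
Defined.
Lemma col_homE X (v : X) w : col_hom v w = act (col w.1 w.2) v.
Proof. exact: hom_ofE. Qed.
Lemma col_hom_modhom X (v : X) : col_hom v \in modhom colmod X.
Proof. by apply/homP=> a w; rewrite !col_homE col_actE actM. Qed.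

Definition col_gen : colmod := (0, 1).
Lemma col_act_gen (w : colmod) : act (col w.1 w.2) col_gen = w.
Proof.
case: w => p x; rewrite /= /col_act /= scale1r mulr1.
by congr pair; rewrite act0 add0r.
Qed.

Definition regular_col : 'Hom(regular A, colmod).
Proof. by apply: (@hom_of k (regular A) colmod (fun a => ((a : A).1.2, (a : A).2))). Defined.
Lemma regular_colE (a : A) : regular_col a = (a.1.2, a.2).
Proof. exact: hom_ofE. Qed.
Lemma regular_col_modhom : regular_col \in modhom (regular A) colmod.
Proof.
by apply/homP=> a v; rewrite !regular_colE.
Qed.

Lemma colmod_retract : retract colmod (regular A).
Proof.
exists (@col_hom (regular A) (1 : A)), regular_col; split.
- exact: col_hom_modhom.
- exact: regular_col_modhom.
- by move=> w; rewrite col_homE /= /reg_act mulr1 regular_colE; case: w.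
Qed.

Lemma proj_colmod : projective colmod.
Proof. exact: proj_retract (@proj_regular _ _) colmod_retract. Qed.

Lemma indec_colmod : indecomposable colmod.
Proof.
apply/indecomposableE; split.
  by move/zeroP/(_ col_gen) => [/eqP]; rewrite oner_eq0.
move=> f fC ff.
(* End (A e_0) is e_0 A e_0 = k: the generator is fixed by e_0, so its image has zero
   P0-component. *)
have [y fy] : exists y : k, forall w, f w = y *: w.
  exists (f col_gen).2 => w; rewrite -{1}(col_act_gen w) (modhomE fC).
  have -> : f col_gen = (0, (f col_gen).2).
    rewrite -{1}[col_gen](col_act_gen col_gen) (modhomE fC) /= /col_act /=.
    by rewrite act0l add0r mul1r scaler0.
  case: w => p x; rewrite /= /col_act /= act0 add0r.
  by congr pair; rewrite mulrC.
have /eqP : y * y = y.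
  have /lfunP/(_ col_gen) := ff; rewrite comp_lfunE !fy => -[_].
  by rewrite /GRing.scale /= !mulr1.
rewrite -subr_eq0 -{3}[y]mulr1 -mulrBr mulf_eq0 subr_eq0 => /orP[]/eqP y1.
  by left; apply/lfunP=> w; rewrite fy y1 scale0r zero_lfunE.
by right; apply/lfunP=> w; rewrite fy y1 scale1r id_lfunE.
Qed.

Lemma infl_col0 M (m : infl P0 M) p x : act (col p x) m = 0.
Proof. exact: act0l. Qed.

Lemma hom_col_infl M (f : 'Hom(colmod, infl P0 M)) :
  f \in modhom colmod (infl P0 M) -> f = 0.
Proof.
move=> fC; apply/lfunP=> w.
by rewrite -(col_act_gen w) (modhomE fC) infl_col0 zero_lfunE.
Qed.

Lemma colmod_infl M : ~ retract colmod (infl P0 M).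
Proof.
case=> [i [p [iC pC ip]]]; apply: (indec_nzero indec_colmod); apply/zeroP=> w.
by rewrite -(ip w) (hom_col_infl iC) zero_lfunE linear0.
Qed.

Lemma regular_onept : iso (dsum (infl P0 (regular B)) colmod) (regular A).
Proof.
have l1 : linear (fun v : dsum (infl P0 (regular B)) colmod =>
    (inj (v.1 : B) + col v.2.1 v.2.2 : A) : regular A).
  move=> c u v /=; rewrite onept_inj_linear onept_col_linear scalerDr.
  by rewrite addrACA.
have l2 : linear (fun a : regular A =>
    ((a : A).1.1, ((a : A).1.2, (a : A).2)) : dsum (infl P0 (regular B)) colmod).
  by [].
apply/isoE; exists (hom_of l1), (hom_of l2); split.
- apply: modhom_of => a [b v]; rewrite col_actE /= /reg_act mulrDr.
  by rewrite mulr_inj.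
- by apply: modhom_of => a v.
- move=> [b [p x]]; rewrite !hom_ofE.
  by congr (_, (_, _)); rewrite /= ?addr0 ?add0r.
- by move=> a; rewrite !hom_ofE -onept_split.
Qed.

Lemma num_regular_onept n : num_summands (regular B) n -> num_summands (regular A) n.+1.
Proof.
move=> Bn; apply: num_iso regular_onept _.
apply: num_dsum; [exact: (ff_num (infl_functor P0)) | exact: indec_colmod | exact: colmod_infl].
Qed.

(** Lifts x_i of the h (b_i) determine the map on a dual basis over B; it is A-linear because A e_B
    = e_B A e_B, which is [mulr_inj]. *)
Lemma proj_infl Q : projective Q -> projective (infl P0 Q).
Proof.
move=> /dual_basis[n [b [g [gC bg]]]] X Y f h fC fT hC.
have H (i : 'I_n) : exists x : X, f x = h (b i).
  by have [x xE] := proj1 (limg_surj f) fT (h (b i)); exists x.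
have [x xE] := fin_all_exists H.
have sl : linear (fun q : infl P0 Q => \sum_i act (inj (g i q : B)) (x i)).
  move=> c u v; rewrite scaler_sumr -big_split; apply: eq_bigr => i _.
  by rewrite linearP onept_inj_linear act_linearl.
exists (hom_of sl).
  apply: modhom_of => a q; rewrite act_sum; apply: eq_bigr => i _.
  by rewrite -actM mulr_inj (modhomE (gC i)).
apply/lfunP=> q; rewrite comp_lfunE hom_ofE linear_sum [in RHS](bg q) linear_sum.
apply: eq_bigr => i _; rewrite /= (modhomE fC) xE -(modhomE hC) //.
Qed.

Lemma proj_infl_inv Q : projective (infl P0 Q) -> projective Q.
Proof.
move=> pQ X Y g h gC gT hC.
have gC' := infl_map_modhom P0 gC; have hC' := infl_map_modhom P0 hC.
have [s sC sE] := pQ (infl P0 X) (infl P0 Y) _ _ gC' gT hC'.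
have [s' s'C ss'] := infl_map_full sC.
by exists s' => //; move: sE; rewrite -ss'.
Qed.

Section Deflation.
Variables (X : fdmod A) (eX : forall v : X, act e v = v).
Definition defl_act (b : B) (v : X) : X := act (inj b) v.
Fact defl_act_linear b : linear (defl_act b).
Proof. exact: act_linear. Qed.
Fact defl_act_linearl v : linear (defl_act^~ v).
Proof. by move=> c a b; rewrite /defl_act onept_inj_linear act_linearl. Qed.
Fact defl_act1 v : defl_act 1 v = v. Proof. exact: eX. Qed.
Fact defl_actM a b v : defl_act (a * b) v = defl_act a (defl_act b v).
Proof. by rewrite /defl_act -mul_inj actM. Qed.
Definition defl : fdmod B :=
  FdMod defl_act_linear defl_act_linearl defl_act1 defl_actM.
Lemma infl_defl : iso X (infl P0 defl).
Proof.
have E a (v : X) : act a v = act (inj (onept_proj a)) v.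
  by rewrite -{1}(eX v) -actM mulr_inj mulr1.
apply/isoE; exists (\1%VF : 'End(X)), (\1%VF : 'End(X)); split.
- by apply/homP=> a v; rewrite !id_lfunE E.
- by apply/homP=> a v; rewrite !id_lfunE [RHS]E.
- by move=> x; rewrite !id_lfunE.
- by move=> x; rewrite !id_lfunE.
Qed.
End Deflation.

Lemma iso_proj (C : falgType k) (M N : fdmod C) : iso M N -> projective M -> projective N.
Proof. by move=> MN pM; apply: proj_retract pM (iso_retract (iso_sym MN)). Qed.

(* If e_0 Pt <> 0, some coordinate Pt -> A of a dual basis does not vanish on
   it, and splits a map A e_0 -> Pt; otherwise Pt is a B-module. *)
Lemma new_projective_iso (Pt : fdmod A) : new_projective Pt -> iso colmod Pt.
Proof.
case=> iP pP nP; apply: retract_indec_iso => //; first exact: (indec_nzero indec_colmod).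
have [v v0] : exists v : Pt, act (col 0 1) v <> 0.
  apply: NNPP => H; case: nP.
  have eP (v : Pt) : act e v = v.
    have v0 : act (col 0 1) v = 0 by apply: NNPP => nv; apply: H; exists v.
    by rewrite -[RHS](act1 v) onept_split1 actDl v0 addr0.
  exists (defl eP); last exact: infl_defl.
  exact/proj_infl_inv/(iso_proj (infl_defl eP)).
have [n [b [g [gC bg]]]] := dual_basis pP.
pose v1 := act (col 0 1) v.
have gv i : g i v1 = (col 0 (g i v : A).2 : A).
  rewrite (modhomE (gC i)) /= /reg_act onept_mulE /=.
  by rewrite mul0r act0l add0r scaler0 mul1r.
have [i gi] : exists i, (g i v : A).2 != 0.
  apply: NNPP => H; apply: v0; rewrite -/v1 (bg v1) big1 // => i _.
  rewrite gv; have [->|] := eqVneq ((g i v : A).2 : k) 0; last by move=> ?; case: H; exists i.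
  exact: act0l.
pose y := (g i v : A).2 : k.
exists (col_hom v1), (y^-1 *: (regular_col \o g i)%VF); split.
- exact: col_hom_modhom.
- by apply: memvZ; apply: modhom_comp regular_col_modhom (gC i).
move=> w; rewrite scale_lfunE comp_lfunE col_homE (modhomE (gC i)) gv /= /reg_act.
rewrite mulr_col regular_colE /= act0l add0r -/y; case: w => p x.
congr pair; first by rewrite /= scalerA mulVf ?scale1r.
by change (y^-1 * (x * y) = x); rewrite mulrC mulfK.
Qed.
End NewProjective.

(** * The new simple module *)

Section NewSimple.
Variables (k : fieldType) (B : falgType k) (P0 : fdmod B).
Local Notation A := (onept P0).
Local Notation inj := (onept_inj P0).
Local Notation e := (onept_e P0).
Local Notation col := (@onept_col k B P0).
Implicit Types (M N Q : fdmod B) (X Y S : fdmod A).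

(** One-dimensional, with A acting through its corner entry: all that the later sections use of
    S. *)
Definition new_simple S := exists s0 : S,
  [/\ s0 <> 0, forall s, exists c, s = c *: s0
    & forall (a : A) (s : S), act a s = (a.2 : k) *: s].

Lemma colmod_submodule_full (W : {vspace colmod P0}) (w : colmod P0) :
  submodule W -> w \in W -> w.2 <> 0 -> W = fullv.
Proof.
move=> WS wW /eqP w0; apply: fullv_mem => v.
suff gW : col_gen P0 \in W by rewrite -(col_act_gen v); apply: WS.
have -> : col_gen P0 = act (col 0 (w.2 : k)^-1) w.
  rewrite /= /col_act /=; case: w {wW} w0 => p x /= x0.
  by congr pair; rewrite ?act0l ?scaler0 ?addr0 // mulVf.
exact: WS.
Qed.

(** An element of A e_0 with nonzero corner coordinate generates it. Hence U, where this coordinate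
    vanishes, is the only maximal submodule, and the top is Pt / U. *)
Lemma top_new_simple (Pt S : fdmod A) : new_projective Pt -> is_top Pt S -> new_simple S.
Proof.
move=> /new_projective_iso/isoE[i [p [iC pC ip pi]]] [f fC [fT fk]].
have rl : linear (fun v : Pt => (p v).2 : k^o) by move=> c u v; rewrite linearP.
pose U := lker (hom_of rl).
have UE v : (v \in U) = ((p v).2 == 0) by rewrite memv_ker hom_ofE.
have US : submodule U.
  by move=> a v; rewrite !UE (modhomE pC) /= => /eqP ->; rewrite mulr0.
have UT : U <> fullv.
  move=> UT; have : i (col_gen P0) \in U by rewrite UT memvf.
  by rewrite UE ip oner_eq0.
have full (W : {vspace Pt}) v : submodule W -> v \in W -> v \notin U -> W = fullv.
  move=> WS vW; rewrite UE => /eqP v2; apply: fullv_mem => w.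
  have WS' : submodule (i @^-1: W)%VS.
    by move=> a x; rewrite -!memv_preim (modhomE iC); apply: WS.
  have := colmod_submodule_full (w := p v) WS' _ v2.
  rewrite -memv_preim pi => /(_ vW) WT.
  by rewrite -(pi w) memv_preim WT memvf.
have fU v : (f v = 0) <-> v \in U.
  split=> [/eqP|vU]; last (apply/eqP; rewrite -memv_ker; apply/fk => W [WS WT Wmax]).
    rewrite -memv_ker => /fk; apply; split=> // W WS UW.
    have [WU|/subvPn[w wW wU]] := boolP (W <= U)%VS.
      by left; apply/eqP; rewrite eqEsubv WU.
    by right; apply: full wW wU.
  have WU : (W <= U)%VS.
    apply/subvPn => -[w wW wU]; exact/WT/(full W w).
  by have [<-|] := Wmax U US WU.
pose s0 := f (i (col_gen P0)).
have fp v : f v = (p v).2 *: s0.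
  apply/eqP; rewrite -subr_eq0 /s0 -linearZ -linearB /=; apply/eqP/fU.
  rewrite UE linearB /= linearZ /= ip; apply/eqP.
  by change ((p v).2 - (p v).2 * 1 = 0); rewrite mulr1 subrr.
exists s0; split.
- by move/fU; rewrite UE ip oner_eq0.
- by move=> s; have [v ->] := proj1 (limg_surj f) fT s; exists (p v).2; apply: fp.
- move=> a s; have [v ->] := proj1 (limg_surj f) fT s.
  by rewrite -(modhomE fC) !fp (modhomE pC) scalerA.
Qed.

Section Simple.
Variables (S : fdmod A) (simS : new_simple S).

Lemma new_simple_act (a : A) (s : S) : act a s = (a.2 : k) *: s.
Proof. by case: simS => s0 [_ _]. Qed.

Lemma new_simple_e (s : S) : act e s = 0.
Proof. by rewrite new_simple_act scale0r. Qed.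

Lemma new_simple_indec : indecomposable S.
Proof.
case: simS => s0 [nz gen aE]; apply/indecomposableE; split.
  by move/zeroP/(_ s0).
move=> f fC ff; have [c fc] := gen (f s0).
have {}fc s : f s = c *: s.
  by have [d ->] := gen s; rewrite linearZ /= fc !scalerA mulrC.
have : (c * c - c) *: s0 = 0.
  have /lfunP/(_ s0) := ff; rewrite comp_lfunE !fc scalerA scalerBl => ->.
  by rewrite subrr.
move/eqP; rewrite scaler_eq0 (introF eqP nz) orbF -{3}[c]mulr1 -mulrBr mulf_eq0 subr_eq0.
case/orP=> /eqP c1; [left|right]; apply/lfunP=> s.
  by rewrite fc c1 scale0r zero_lfunE.
by rewrite fc c1 scale1r id_lfunE.
Qed.

(** By adjunction such maps are the B-maps from e_B S = 0 to M. *)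
Lemma hom_new_simple_ext M (f : 'Hom(S, ext P0 M)) :
  f \in modhom S (ext P0 M) -> f = 0.
Proof.
move=> fC; apply: ext_hom_inj; rewrite ?mem0v // => s.
rewrite zero_lfunE linear0 -(semihom_e _ (@counit_semihom _ _ P0 M)) -(modhomE fC).
by rewrite new_simple_e !linear0.
Qed.

Lemma hom_infl_new_simple M (f : 'Hom(infl P0 M, S)) :
  f \in modhom (infl P0 M) S -> f = 0.
Proof.
move=> fC; apply/lfunP=> m.
by rewrite -(infl_e m) (modhomE fC) new_simple_e zero_lfunE.
Qed.

Lemma new_simple_ext M : ~ retract S (ext P0 M).
Proof.
case=> [i [p [iC pC ip]]]; apply: (indec_nzero new_simple_indec); apply/zeroP=> w.
by rewrite -(ip w) (hom_new_simple_ext iC) zero_lfunE linear0.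
Qed.
End Simple.
End NewSimple.

(** * Tau-rigidity of the extended module *)

Section TauRigidExtension.
Variables (k : fieldType) (B : falgType k) (P0 : fdmod B).
Local Notation A := (onept P0).
Local Notation inj := (onept_inj P0).
Local Notation e := (onept_e P0).
Local Notation col := (@onept_col k B P0).
Variables (S : fdmod A) (simS : new_simple S) (pP0 : projective P0).

Section Presentation.
Variables (M : fdmod B) (rM : tau_rigid M).
Local Notation X := (dsum (ext P0 M) S).
Variables (Q : fdmod B) (g0 : 'Hom(Q, M)).
Hypotheses (pQ : projective Q) (g0C : g0 \in modhom Q M) (g0T : limg g0 = fullv).

(* R0 -> X = E M (+) S is bijective on the e_0-components, thanks to the copies
   of A e_0 indexed by a basis of V = e_0 X.  Hence its kernel is a B-module,
   equal to the kernel of e_B R0 = Q2 -> M. *)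
Let V := limg (act_lfun X (col 0 1)).
Let d := \dim V.
Let b := vbasis V.
Let R0 := dsum (infl P0 Q) (pow d (colmod P0)).
Let Q2 := dsum Q (pow d P0).

Let b_e0 (i : 'I_d) c : act (col 0 c) (b`_i : X) = c *: (b`_i : X).
Proof.
have : b`_i \in V by apply/vbasis_mem/mem_nth; rewrite size_tuple.
move=> /memv_imgP[x _ ->]; rewrite lfunE.
change (act (col 0 c) (act (col 0 1) x) = c *: act (col 0 1) x).
rewrite -actM -actZl; congr (act _ x).
by rewrite mulr_col /= act0l scaler0 addr0; congr (_, _, _); rewrite /= ?scaler0.
Qed.

Let gq : 'Hom(infl P0 Q, ext P0 M) := adj (g0 : 'Hom(infl P0 Q, M)).
Let gqC : gq \in modhom (infl P0 Q) (ext P0 M).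
Proof. exact/adj_modhom/infl_semihom. Qed.

Let counit_gq q : counit P0 M (gq q) = g0 q.
Proof. exact/counit_adj/infl_semihom. Qed.

Let g : 'Hom(R0, X) :=
  ((dinl _ S \o (gq \o dfst _ _)) +
   (\sum_(i < d) (col_hom (b`_i : X) \o (pproj (colmod P0) i \o dsnd _ _))%VF))%VF.
Let gC : g \in modhom R0 X.
Proof.
apply: modhomD; first by have ? := gqC; modhom.
apply: memv_suml => i _; apply: modhom_comp; first exact: col_hom_modhom.
by apply: modhom_comp; [exact: pproj_modhom | exact: dsnd_modhom].
Qed.
Let gE z : g z = (gq z.1, 0) + \sum_(i < d) act (col (z.2 i).1 (z.2 i).2) (b`_i : X).
Proof.
rewrite add_lfunE !comp_lfunE dfstE dinlE sum_lfunE; congr (_ + _).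
by apply: eq_bigr => i _; rewrite !comp_lfunE dsndE pprojE col_homE.
Qed.

(** [j2] and [pr2] identify Q2 with e_B R0. *)
Let j2 : 'Hom(infl P0 Q2, R0).
Proof.
apply: (@hom_of k (infl P0 Q2) R0 (fun z => (z.1, [ffun i => (z.2 i, 0)]))).
move=> c u v; congr pair; apply/ffunP=> i; rewrite !ffunE /=.
by congr pair; rewrite /= scaler0 addr0.
Defined.
Let j2E z : j2 z = (z.1, [ffun i => (z.2 i, 0)]). Proof. exact: hom_ofE. Qed.
Let j2C : j2 \in modhom (infl P0 Q2) R0.
Proof.
apply/homP=> a v; rewrite !j2E; congr pair; apply/ffunP=> i; rewrite !ffunE /=.
by congr pair; rewrite /= ?scale0r ?addr0 ?mulr0.
Qed.

Let pr2 : 'Hom(R0, Q2).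
Proof.
apply: (@hom_of k R0 Q2 (fun z => (z.1, [ffun i => (z.2 i).1]))).
by move=> c u v; congr pair; apply/ffunP=> i; rewrite !ffunE.
Defined.
Let pr2E z : pr2 z = (z.1, [ffun i => (z.2 i).1]). Proof. exact: hom_ofE. Qed.
Let pr2S : semihom pr2.
Proof.
move=> c z; rewrite !pr2E; congr pair; apply/ffunP=> i; rewrite !ffunE /=.
by rewrite scaler0 addr0.
Qed.
Let pr2K z : pr2 (j2 z) = z.
Proof.
case: z => q w; rewrite j2E pr2E /=; congr pair.
by apply/ffunP=> i; rewrite !ffunE.
Qed.

Let g2 : 'Hom(Q2, M) := (counit P0 M \o (dfst _ S \o (g \o j2)))%VF.
Let g2C : g2 \in modhom Q2 M.
Proof.
apply/homP=> c z; rewrite /g2 !comp_lfunE -counit_semihom.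
rewrite -(modhomE (dfst_modhom _ _)) -(modhomE gC) -(modhomE j2C) //.
Qed.

Let e_val (w : ext P0 M) (s : S) : act e ((w, s) : X) = (w, s) -> act e w = w /\ s = 0.
Proof. by move=> [ew /esym]; rewrite (new_simple_e simS). Qed.

Let g2T : limg g2 = fullv.
Proof.
apply/limg_surj=> m; have [q ->] := proj1 (limg_surj g0) g0T m.
exists (q, 0); rewrite !comp_lfunE dfstE j2E gE big1 /=.
  by rewrite addr0; apply/esym/counit_gq.
by move=> i _; rewrite !ffunE; apply: (act0l (b`_i : X)).
Qed.

Let gT : limg g = fullv.
Proof.
apply/limg_surj=> y.
(* As 1 = e_B + e_0, the two components of y are reached separately: e_B y from Q, and e_0 y from
   the copies of A e_0. *)
have [z1 yz1] : exists z, act e y = g z.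
  case: y => w s; have [q qE] := proj1 (limg_surj g0) g0T (counit P0 M w).
  exists (q, 0); rewrite gE big1 ?addr0 /=.
    congr pair; last exact: new_simple_e.
    apply: ext_inj_e; first exact: ee_idem.
      by rewrite -(modhomE gqC) infl_e.
    by rewrite (semihom_e _ (@counit_semihom _ _ P0 M)) qE counit_gq.
  by move=> i _; rewrite ffunE; apply: (act0l (b`_i : X)).
have [z2 yz2] : exists z, act (col 0 1) y = g z.
  have yV : act (col 0 1) y \in V.
    by apply/memv_imgP; exists y; rewrite ?memvf // lfunE.
  exists (0, [ffun i => (0, coord b i (act (col 0 1) y))]).
  rewrite gE [gq _]linear0 add0r {1}(coord_vbasis yV); apply: eq_bigr => i _.
  by rewrite ffunE; apply/esym/b_e0.
exists (z1 + z2); rewrite [RHS]linearD; change (y = g z1 + g z2).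
by rewrite -yz1 -yz2 -actDl -onept_split1 act1.
Qed.

Let ker_g z : g z = 0 -> z = j2 (pr2 z).
Proof.
case: z => q w gz.
have sum0 : \sum_(i < d) (w i).2 *: (b`_i : X) = 0.
  transitivity (g (act (col 0 1) ((q, w) : R0))); last by rewrite (modhomE gC) gz act0.
  have -> : act (col 0 1) ((q, w) : R0) = (0, [ffun i => (0, (w i).2)]).
    congr pair; first exact: act0l.
    apply/ffunP=> i; rewrite !ffunE /= /col_act /=.
    by rewrite act0l scaler0 addr0 mul1r.
  rewrite gE [gq _]linear0 add0r; apply: eq_bigr => i _.
  by rewrite ffunE; apply/esym/b_e0.
(* Applying e_0 to g z = 0 leaves a linear relation between the basis vectors of V. *)
have w0 i : (w i).2 = 0.
  by move/freeP: (basis_free (vbasisP V)) => /(_ (fun i => (w i).2) sum0); apply.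
rewrite pr2E j2E; congr pair; apply/ffunP=> i; rewrite !ffunE.
by case: (w i) (w0 i) => p x /= ->.
Qed.

Let ker_g2 z : g2 z = 0 -> g (j2 z) = 0.
Proof.
move=> g2z; have : act e (g (j2 z)) = g (j2 z).
  by rewrite -(modhomE gC) -(modhomE j2C) infl_e.
have : counit P0 M (g (j2 z)).1 = 0 by move: g2z; rewrite !comp_lfunE dfstE.
case: (g (j2 z)) => w s w0 /e_val[ew ->]; congr pair.
by apply: ext_inj_e; rewrite ?act0 ?linear0.
Qed.

Let g2_ker z : g (j2 z) = 0 -> g2 z = 0.
Proof. by move=> gz; rewrite !comp_lfunE gz !linear0. Qed.

Lemma tau_rigid_ext_sum_from_cover : tau_rigid X.
Proof.
have [R1 [f2 [pR1 f2C f2k sf2]]] := kernel_cover g2C.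
have pQ2 : projective Q2 by apply: proj_dsum => //; apply: proj_pow.
(* Q2 -> M need not be a cover; it suffices that f2 covers its kernel. *)
have f2M := tau_rigid_cover rM (And3 (conj pR1 pQ2) (conj f2C g2C) (conj g2T f2k)) sf2.
pose f : 'Hom(infl P0 R1, R0) := (j2 \o (f2 : 'Hom(infl P0 R1, infl P0 Q2)))%VF.
have fE r : f r = j2 (f2 r) by rewrite comp_lfunE.
have fC : f \in modhom (infl P0 R1) R0.
  exact/modhom_comp/infl_map_modhom.
apply/tau_rigidE; exists (infl P0 R1), R0, f, g; split.
  split; [split | split | split] => //.
  - exact: proj_infl.
  - apply: proj_dsum; first exact: proj_infl.
    exact/proj_pow/proj_colmod.
  - apply/vspaceP=> z; rewrite memv_ker; apply/memv_imgP/eqP => [[r _ ->]|gz].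
      rewrite fE; apply/ker_g2/eqP; rewrite -memv_ker -f2k.
      exact/memv_img/memvf.
    have : pr2 z \in lker g2.
      by rewrite memv_ker; apply/eqP/g2_ker; rewrite -ker_g.
    rewrite -f2k => /memv_imgP[r _ rE]; exists r; rewrite ?memvf //.
    by rewrite fE -rE -ker_g.
(* h is defined on a B-module, so its values are fixed by e_B: they have no S-component and are
   determined by h1. The problem is solved over B by t and carried back by the adjoint of t pr2. *)
move=> h hC; pose h1 : 'Hom(R1, M) := (counit P0 M \o (dfst _ S \o h))%VF.
have h1C : h1 \in modhom R1 M.
  apply/homP=> c r; rewrite !comp_lfunE -counit_semihom.
  by rewrite -(modhomE (dfst_modhom _ _)) -(modhomE hC).
have [t tC tE] := f2M h1 h1C.
have phiS : semihom (t \o pr2)%VF by apply: semihom_comp.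
exists (dinl _ S \o adj (t \o pr2)%VF)%VF.
  by apply: modhom_comp (dinl_modhom _ _) (adj_modhom phiS).
move=> r; rewrite comp_lfunE dinlE fE.
have : act e (h r) = h r by rewrite -(modhomE hC) infl_e.
have : counit P0 M (h r).1 = h1 r by rewrite !comp_lfunE dfstE.
case: (h r) => w s hr /e_val[ew ->]; congr pair.
apply: ext_inj_e => //.
  by rewrite -(modhomE (adj_modhom phiS)) -(modhomE j2C) infl_e.
by rewrite counit_adj // comp_lfunE pr2K tE hr.
Qed.
End Presentation.

Lemma tau_rigid_ext_sum M : tau_rigid M -> tau_rigid (dsum (ext P0 M) S).
Proof.
move=> rM; have [Q [g0 [pQ g0C g0T _]]] := proj_cover M.
exact: (tau_rigid_ext_sum_from_cover rM (g0 := g0)).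
Qed.
End TauRigidExtension.

(** * The embedding of quivers *)

Section Pairs.
Variables (k : fieldType) (C : falgType k).
Implicit Types (M N X Y : fdmod C) (T : mod_pair C).

Lemma hom_retract0 M N X Y : retract X M -> retract Y N ->
  modhom M N = 0%VS -> modhom X Y = 0%VS.
Proof.
move=> [i [p [iC pC ip]]] [j [q [jC qC jq]]] MN0.
apply/eqP; rewrite -subv0; apply/subvP=> h hC; rewrite memv0; apply/eqP/lfunP=> x.
have : (j \o (h \o p))%VF \in modhom M N by modhom.
rewrite MN0 memv0 => /eqP/lfunP/(_ (i x)).
by rewrite !comp_lfunE ip !zero_lfunE -{2}(jq (h x)) => ->; rewrite linear0.
Qed.

Lemma tau_rigid_pair_retract T N Q : tau_rigid_pair T ->
  retract N T.1 -> retract Q T.2 -> tau_rigid_pair (N, Q).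
Proof.
move=> [pT rT hT] NT QT; split=> /=.
- exact: proj_retract pT QT.
- exact: tau_rigid_retract rT NT.
- exact: hom_retract0 QT NT hT.
Qed.

(** Neither component can have more summands than that of T, so equal totals force equality in
    both. *)
Lemma full_retract_iso T N Q n m p : basic_pair T -> pair_size T n ->
  retract N T.1 -> retract Q T.2 -> num_summands N m -> num_summands Q p ->
  (m + p)%N = n -> iso N T.1 /\ iso Q T.2.
Proof.
move=> [b1 b2] [m' [p' [Tm Tp <-]]] NT QT Nm Qp mp.
have mm := num_retract_le NT Nm Tm; have pp := num_retract_le QT Qp Tp.
have E : m = m' /\ p = p'.
  have mE : m = m'.
    apply/eqP; rewrite eqn_leq mm /= -(leq_add2r p') -mp leq_add2l //.
  by split=> //; apply/eqP; rewrite -(eqn_add2l m) mp mE.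
case: E => E1 E2; subst m' p'.
by split; [apply: basic_num_iso Nm Tm | apply: basic_num_iso Qp Tp].
Qed.
End Pairs.

Section OnePointExtension.
Variables (k : fieldType) (B : falgType k) (P0 : fdmod B).
Local Notation A := (onept P0).
Variables (S : fdmod A) (simS : new_simple S) (pP0 : projective P0).
Implicit Types (M N Q : fdmod B) (T : mod_pair B).
Local Notation F := (ext_functor P0).
Local Notation G := (infl_functor P0).
Local Notation E := (ext_pair S).

Lemma hom_infl_ext_sum M Q : modhom Q M = 0%VS ->
  modhom (infl P0 Q) (dsum (ext P0 M) S) = 0%VS.
Proof.
move=> QM0; apply/eqP; rewrite -subv0; apply/subvP=> h hC; rewrite memv0.
have h1C : (dfst (ext P0 M) S \o h)%VF \in modhom (infl P0 Q) (ext P0 M) by modhom.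
have h2 : (dsnd (ext P0 M) S \o h)%VF = 0.
  by apply: (hom_infl_new_simple simS); modhom.
have h1 : (dfst (ext P0 M) S \o h)%VF = 0.
  apply: ext_hom_inj => // [|q]; first exact: mem0v.
  have : (counit P0 M \o (dfst (ext P0 M) S \o h))%VF \in modhom Q M.
    apply/homP=> c x; rewrite !(comp_lfunE (counit P0 M)) -counit_semihom.
    by rewrite -(modhomE h1C).
  rewrite QM0 memv0 => /eqP/lfunP/(_ q).
  by rewrite comp_lfunE => ->; rewrite !zero_lfunE linear0.
apply/eqP/lfunP=> q; rewrite (dsum_split (h q)) zero_lfunE.
have /lfunP/(_ q) := h1; rewrite comp_lfunE zero_lfunE => ->.
have /lfunP/(_ q) := h2; rewrite comp_lfunE zero_lfunE => ->.
by rewrite !linear0 addr0.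
Qed.

Lemma ext_tau_rigid_pair T : tau_rigid_pair T -> tau_rigid_pair (E T).
Proof.
case=> pT rT hT; split.
- exact: proj_infl.
- exact: tau_rigid_ext_sum.
- exact: hom_infl_ext_sum.
Qed.

Lemma ext_basic_pair T : basic_pair T -> basic_pair (E T).
Proof.
case=> b1 b2; split; last exact: (@ff_basic _ _ _ G _ b2).
apply: basic_dsum; first exact: (@ff_basic _ _ _ F _ b1).
  exact: new_simple_indec.
exact: new_simple_ext.
Qed.

Lemma ext_pair_size T n : pair_size T n -> pair_size (E T) n.+1.
Proof.
case=> m [p [Tm Tp <-]]; exists m.+1, p; split; last by rewrite addSn.
  apply: num_dsum; [exact: (ff_num F Tm) | exact: new_simple_indec | exact: new_simple_ext].
exact: (ff_num G Tp).
Qed.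

Lemma ext_stau_tilt T : stau_tilt T -> stau_tilt (E T).
Proof.
move=> [bT [rT [n Bn Tn]]]; split; first exact: ext_basic_pair.
split; first exact: ext_tau_rigid_pair.
by exists n.+1; [exact: num_regular_onept | exact: ext_pair_size].
Qed.

Lemma ext_almost_complete T : almost_complete_pair T -> almost_complete_pair (E T).
Proof.
move=> [rT [n Bn Tn]]; split; first exact: ext_tau_rigid_pair.
by exists n.+1; [exact: num_regular_onept | exact: ext_pair_size].
Qed.

Lemma ext_retract M N : retract M N ->
  retract (dsum (ext P0 M) S) (dsum (ext P0 N) S).
Proof.
move=> MN; apply: retract_dsum; last exact: retract_refl.
exact: (proj1 (ff_retract F M N)).
Qed.

(** Since Hom(S, E M) = 0, maps between such sums are triangular, and the corner E M -> E N of an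
    isomorphism is an isomorphism. *)
Lemma ext_sum_iso M N : iso M N <-> iso (dsum (ext P0 M) S) (dsum (ext P0 N) S).
Proof.
split=> [MN|/isoE[f [g [fC gC fK gK]]]].
  by apply: iso_dsum; [exact: (proj1 (ff_iso F M N)) | exact: iso_refl].
apply/(ff_iso F)/isoE.
pose c M N (h : 'Hom(dsum (ext P0 M) S, dsum (ext P0 N) S)) :=
  (dfst (ext P0 N) S \o (h \o dinl (ext P0 M) S))%VF.
have cC M' N' h : h \in modhom (dsum (ext P0 M') S) (dsum (ext P0 N') S) ->
    c M' N' h \in modhom (ext P0 M') (ext P0 N') by move=> hC; rewrite /c; modhom.
have cK M' N' (h : 'Hom(dsum (ext P0 M') S, dsum (ext P0 N') S)) h' :
    h' \in modhom (dsum (ext P0 N') S) (dsum (ext P0 M') S) ->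
    cancel h h' -> cancel (c _ _ h) (c _ _ h').
  move=> h'C hK x; rewrite !comp_lfunE.
  have z : (dfst (ext P0 M') S \o (h' \o dinr (ext P0 N') S))%VF = 0.
    by apply: (hom_new_simple_ext simS); modhom.
  set y := h (dinl (ext P0 M') S x).
  have /lfunP/(_ (dsnd (ext P0 N') S y)) := z; rewrite !comp_lfunE zero_lfunE => z'.
  transitivity (dfst (ext P0 M') S (h' y)); last by rewrite hK dinlE dfstE.
  by rewrite [in RHS](dsum_split y) !linearD /= z' addr0.
by exists (c _ _ f), (c _ _ g); split; [exact: cC | exact: cC | exact: cK | exact: cK].
Qed.

Lemma ext_pair_iso T T' : pair_iso T T' <-> pair_iso (E T) (E T').
Proof.
split=> -[i1 i2]; split.
- exact/ext_sum_iso.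
- exact: (proj1 (ff_iso G _ _)).
- exact/ext_sum_iso.
- exact: (proj2 (ff_iso G _ _)).
Qed.

(** As a left B-module U is B (+) P0, the first row of the matrices. *)
Lemma proj_extU : projective (extU P0).
Proof.
apply: (@proj_retract _ _ (dsum (regular B) P0)).
  by apply: proj_dsum => //; apply: proj_regular.
have l1 : linear (fun u : extU P0 =>
  ((vsval u).1.1, (vsval u).1.2) : dsum (regular B) P0) by [].
have l2 : linear (fun v : dsum (regular B) P0 =>
  vsproj (extU_space P0) ((v.1 : B), v.2, 0) : extU P0).
  move=> c u v; rewrite -linearP; congr (vsproj _ _).
  by congr (_, _, _); rewrite /= scaler0 addr0.
have inU (b : B) (p : P0) : ((b, p, 0) : A) \in extU_space P0.
  apply/extU_spaceP; rewrite onept_mulE /=.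
  by rewrite mul1r act1 scale0r addr0 mul0r.
exists (hom_of l1), (hom_of l2); split.
- apply: modhom_of => b u; rewrite extU_actE onept_mulE /= /dsum_act /=.
  by rewrite scaler0 addr0.
- apply: modhom_of => b v; apply: subvs_inj; rewrite extU_actE !vsprojK //.
  by rewrite onept_mulE /= scaler0 addr0 mulr0.
- move=> u; rewrite !hom_ofE; apply: subvs_inj; rewrite vsprojK //.
  by case: (vsval u) (extU_val2 u) => [[b p] x] /= ->.
Qed.

Lemma Fac_ext M N : Fac M N <-> Fac (dsum (ext P0 M) S) (dsum (ext P0 N) S).
Proof.
split=> [[n [f fC fT]]|/FacE H]; apply/FacE=> W HW.
  apply: fullv_mem => v; rewrite (dsum_split v); apply: memvD; last first.
    have sC : (dinr (ext P0 N) S \o dsnd (ext P0 M) S)%VF \in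
       modhom (dsum (ext P0 M) S) (dsum (ext P0 N) S) by modhom.
    apply/(subvP (HW _ sC)); apply/memv_imgP.
    exists (dinr (ext P0 M) S (dsnd _ S v)); rewrite ?memvf // comp_lfunE.
    by rewrite [dinr (ext P0 M) S _]dinrE !dsndE.
  move: (dfst _ S v) => w.
  (* An element of E N is a map U -> N; it lifts to M^n as U is projective, and the components of
     the lift are elements of E M. *)
  have [w' w'C w'E] := proj_extU fC fT (subvsP w).
  pose wi i : ext P0 M := vsproj (modhom (extU P0) M) (pproj M i \o w')%VF.
  have fiC i : (f \o pinj M i)%VF \in modhom M N by apply: modhom_comp fC (pinj_modhom _ _).
  have -> : w = \sum_i ext_map P0 (f \o pinj M i)%VF (wi i).
    apply/subvs_inj/lfunP=> u; rewrite linear_sum sum_lfunE -{1}w'E comp_lfunE.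
    rewrite (pow_sum (w' u)) linear_sum; apply: eq_bigr => i _ /=.
    apply/esym; apply: etrans (ext_mapE _ _ (fiC i)) _.
    rewrite comp_lfunE vsprojK ?comp_lfunE //.
    by apply: modhom_comp w'C; apply: pproj_modhom.
  rewrite linear_sum; apply: memv_suml => i _ /=.
  have gC := ext_map_modhom P0 (fiC i).
  have hC : (dinl (ext P0 N) S \o (ext_map P0 (f \o pinj M i) \o dfst (ext P0 M) S))%VF
      \in modhom (dsum (ext P0 M) S) (dsum (ext P0 N) S) by modhom.
  apply/(subvP (HW _ hC)); apply/memv_imgP.
  exists (dinl (ext P0 M) S (wi i)); rewrite ?memvf // !comp_lfunE !dinlE dfstE; apply: dinlE.
apply: fullv_mem => x.
(* Followed by c, a map E M (+) S -> E N (+) S vanishes on S and on E M is the counit followed by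
   some f : M -> N, so its image lies in W. *)
pose c := (counit P0 N \o dfst (ext P0 N) S)%VF.
suff cW : (c @^-1: W)%VS = fullv.
  have -> : x = c (dinl (ext P0 N) S (ext_unit P0 N x)).
    by rewrite comp_lfunE dinlE dfstE counit_unit.
  by rewrite memv_preim cW memvf.
apply: H => h hC; apply/subvP=> _ /memv_imgP[v _ ->]; rewrite -memv_preim.
have g1C : (dfst (ext P0 N) S \o (h \o dinl (ext P0 M) S))%VF \in
  modhom (ext P0 M) (ext P0 N) by modhom.
have g20 : (dfst (ext P0 N) S \o (h \o dinr (ext P0 M) S))%VF = 0.
  by apply: (hom_new_simple_ext simS); modhom.
have [f fC fE] := ext_map_full g1C.
have -> : c (h v) = f (counit P0 M (dfst _ S v)).
  rewrite -counit_map // fE !comp_lfunE; congr (counit P0 N _).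
  have /lfunP/(_ (dsnd _ S v)) := g20; rewrite !comp_lfunE zero_lfunE => z.
  by rewrite {1}(dsum_split v) !linearD /= z addr0.
exact/(subvP (HW _ fC))/memv_img/memvf.
Qed.

Lemma ext_stau_le T T' : stau_le T T' <-> stau_le (E T) (E T').
Proof.
split=> le X; [move=> TX | move=> TX].
  by apply: Fac_trans TX; apply/Fac_ext/le/Fac_refl.
by apply: Fac_trans TX; apply/Fac_ext/le/Fac_refl.
Qed.

Lemma ext_common_summand T T' (N : mod_pair A) : basic_pair T -> basic_pair T' ->
  forall n, num_summands (regular B) n -> pair_size T n -> pair_size T' n ->
  tau_rigid_pair T -> ~ pair_iso T T' ->
  basic_pair N -> almost_complete_pair N ->
  pair_summand N (E T) -> pair_summand N (E T') ->
  exists N' : mod_pair B, [/\ basic_pair N', almost_complete_pair N',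
                 pair_summand N' T & pair_summand N' T'].
Proof.
move=> bT bT' n Bn Tn T'n rT nTT' [bN1 bN2] [rN [n' An' [m [p [Nm Np mp]]]]].
move=> [/summandE N1T /summandE N2T] [/summandE N1T' /summandE N2T'].
have [E'] := num_unique An' (num_regular_onept P0 Bn); rewrite {}E' in mp An'.
have [Q QT N2Q] := ff_split (F := G) N2T.
have QT' : retract Q T'.2.
  by apply/(ff_retract G); apply: retract_trans (iso_retract (iso_sym N2Q)) N2T'.
have Qp : num_summands Q p.
  have [p' Qp'] := num_exists Q.
  by have := num_unique Np (num_iso (iso_sym N2Q) (ff_num G Qp')) => ->.
have split_ext Y : ~ retract S Y -> retract Y (E T).1 -> retract Y (E T').1 ->
    exists M, [/\ iso Y (ext P0 M), retract M T.1 & retract M T'.1].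
  move=> nSY /(retract_absorb (new_simple_indec simS) nSY) YT.
  move=> /(retract_absorb (new_simple_indec simS) nSY) YT'.
  have [M MT YM] := ff_split (F := F) YT; exists M; split=> //.
  by apply/(ff_retract F); apply: retract_trans (iso_retract (iso_sym YM)) YT'.
have num_ext Y M q : iso Y (ext P0 M) -> num_summands Y q -> num_summands M q.
  move=> YM Yq; have [q' Mq'] := num_exists M.
  by have := num_unique Yq (num_iso (iso_sym YM) (ff_num F Mq')) => ->.
(* Without S, the pair N would come from a pair over B of size n that is a summand of both T and T'.
   Having their full size, it would be isomorphic to both. *)
have [SN1|nSN1] := classic (retract S N.1); last first.
  have [M [N1M MT MT']] := split_ext _ nSN1 N1T N1T'.
  have Mm := num_ext _ _ _ N1M Nm.
  have [i1 i2] := full_retract_iso bT Tn MT QT Mm Qp mp.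
  have [j1 j2] := full_retract_iso bT' T'n MT' QT' Mm Qp mp.
  by case: nTT'; split; [apply: iso_trans (iso_sym i1) j1 | apply: iso_trans (iso_sym i2) j2].
have iS := new_simple_indec simS.
have [Y N1SY] := proj2 (summandE _ _) SN1.
have N1YS : iso N.1 (dsum Y S) by apply: iso_trans N1SY (iso_dsumC _ _).
have YN1 : retract Y N.1.
  by apply: retract_trans (retract_inl Y S) (iso_retract (iso_sym N1YS)).
(* S occurs only once in the basic module [N.1], so removing it lowers the count by exactly one. *)
have nSY : ~ retract S Y.
  move=> SY; move/basicE: bN1 => /(_ S S iS iS _ (iso_refl S)); apply.
  apply: retract_trans (iso_retract (iso_sym N1YS)).
  by apply: retract_dsum => //; apply: retract_refl.
have [M [YM MT MT']] := split_ext _ nSY (retract_trans YN1 N1T) (retract_trans YN1 N1T').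
have [m' Ym'] := num_exists Y.
have mE : m = m'.+1 := num_unique Nm (num_iso (iso_sym N1YS) (num_dsum Ym' iS nSY)).
exists (M, Q); split; first last.
- by split; apply/summandE.
- by split; apply/summandE.
- split; first exact: tau_rigid_pair_retract rT MT QT.
  exists (m' + p)%N; first by rewrite -addSn -mE mp.
  by exists m', p; split=> //; apply: num_ext YM Ym'.
- by split; [apply: basic_retract MT; case: bT | apply: basic_retract QT; case: bT].
Qed.

Lemma ext_full_embedding :
  @full_embedding (Q_stau_tilt B) (Q_stau_tilt A) E.
Proof.
split=> /=.
- exact: ext_stau_tilt.
- by move=> x y _ _ /ext_pair_iso.
- by move=> x y _ _ /ext_pair_iso.
move=> x y [bx [rx [n Bn xn]]] [by_ [ry [n' Bn' yn]]].
have En := num_unique Bn Bn'; subst n'.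
split=> -[[nxy [N [bN aN Nx Ny]]] [le nyx]].
  split; split.
  - by move/ext_pair_iso.
  - exists (E N); split; [exact: ext_basic_pair | exact: ext_almost_complete | |].
      case: Nx => /summandE r1 /summandE r2; split; apply/summandE; first exact: ext_retract.
      exact: (proj1 (ff_retract G _ _)).
    case: Ny => /summandE r1 /summandE r2; split; apply/summandE; first exact: ext_retract.
    exact: (proj1 (ff_retract G _ _)).
  - exact/ext_stau_le.
  - by move/ext_pair_iso.
have nxy' : ~ pair_iso x y by move/ext_pair_iso.
split; split=> //.
- exact: (ext_common_summand bx by_ Bn xn yn rx nxy' bN aN Nx Ny).
- exact/ext_stau_le.
- by move/ext_pair_iso.
Qed.
End OnePointExtension.

Theorem theoremB (k : closedFieldType) (B : falgType k) (P0 : fdmod B)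
    (Pt S : fdmod (onept P0)) :
  basic_algebra B -> connected_algebra B -> projective P0 ->
  new_projective Pt -> is_top Pt S ->
  @full_embedding (Q_stau_tilt B) (Q_stau_tilt (onept P0)) (ext_pair S).
Proof.
move=> _ _ pP0 nPt tS.
exact: ext_full_embedding (top_new_simple nPt tS) pP0.
Qed.
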